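(* For any $r\in(0,1)$ there is a sequence $\{v_m\}$ such that the rates $r_m$ of the extended BCH codes $\mathrm{eBCH}(v_m,m)$ satisfy $r_m\to r$ and the sequence $\{\mathrm{eBCH}(v_m,m)\}_m$ is capacity achieving on the BEC under block-MAP decoding.
   Context: Let $\alpha$ be a primitive element of $\mathbb{F}_{2^m}$. For $1\le v\le 2^m-1$, let $f(m,v)$ be the lowest-degree polynomial over $\mathbb{F}_2$ having $\alpha,\alpha^2,\dots,\alpha^v$ as roots; $\mathrm{BCH}(v,m)$ is the binary cyclic code of length $2^m-1$ with generator polynomial $f(m,v)$. $\mathrm{eBCH}(v,m)$ is the length-$2^m$ code obtained by appending to each codeword of $\mathrm{BCH}(v,m)$ an overall parity bit making the total weight even. A uniform codeword $\underline{X}$ is sent over $\mathrm{BEC}(p)$ (each bit independently erased with probability $p$) giving $\underline{Y}$; $P_B(p)$ is the probability that $\underline{X}$ is not uniquely determined by $\underline{Y}$. A sequence with rates $r_n\to r\in(0,1)$ is capacity achieving under block-MAP decoding if $P_B^{(n)}(p)\to0$ for all $p\in[0,1-r)$. *)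

(* Defs.v *)
From Stdlib Require Import Reals ClassicalEpsilon.
From HB Require Import structures.
From mathcomp Require Import all_boot all_order all_algebra all_field.
Set Implicit Arguments. Unset Strict Implicit. Unset Printing Implicit Defensive.
Import GRing.Theory.

Definition pbool (P : Prop) : bool :=
  if excluded_middle_informative P then true else false.

Section BCH.
Local Open Scope ring_scope.
Variable (F : finFieldType) (alpha : F).

(* the embedding of the prime field F_2 into F (a ring morphism when char F = 2) *)
Definition emb2 (b : 'F_2) : F := (nat_of_ord b)%:R.

Definition has_BCH_roots (v : nat) (g : {poly 'F_2}) : Prop :=
  forall i : nat, (1 <= i <= v)%N -> root (map_poly emb2 g) (alpha ^+ i).

Definition is_BCH_gen (v : nat) (g : {poly 'F_2}) : Prop :=
  g != 0 /\ has_BCH_roots v g /\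
  forall h : {poly 'F_2}, h != 0 -> has_BCH_roots v h -> (size g <= size h)%N.

Definition BCH_word (m v : nat) (c : {ffun 'I_(2 ^ m - 1) -> 'F_2}) : Prop :=
  exists g, is_BCH_gen v g /\ (g %| \sum_(i < 2 ^ m - 1) (c i)%:P * 'X^i).

Definition BCH (m v : nat) : {set {ffun 'I_(2 ^ m - 1) -> 'F_2}} :=
  [set c | pbool (@BCH_word m v c)].

(* eBCH(v,m): length 2^m; the first 2^m - 1 coordinates form a BCH codeword and
   the last one is the overall parity bit, so the total weight is even. *)
Definition eBCH (m v : nat) : {set {ffun 'I_(2 ^ m) -> 'F_2}} :=
  [set y : {ffun 'I_(2 ^ m) -> 'F_2} | [ffun i : 'I_(2 ^ m - 1) => y (widen_ord (leq_subr 1 (2 ^ m)) i)] \in BCH m v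
           & \sum_(i < 2 ^ m) y i == 0].

End BCH.

Section Channel.
Local Open Scope R_scope.
Variable N : nat.
Implicit Types (C : {set {ffun 'I_N -> 'F_2}}).

Definition rate C : R := (ln (INR #|C|) / ln 2) / INR N.

(* x is not uniquely determined by the output when the positions in E are erased *)
Definition ambiguous C (x : {ffun 'I_N -> 'F_2}) (E : {set 'I_N}) : bool :=
  [exists x' in C, (x' != x) && [forall i, (i \notin E) ==> (x' i == x i)]].

Definition PB C (p : R) : R :=
  \big[Rplus/0]_(x in C) \big[Rplus/0]_(E : {set 'I_N})
     (/ INR #|C| * (p ^ #|E| * (1 - p) ^ (N - #|E|)) *
      (if ambiguous C x E then 1 else 0)).

End Channel.

(* Main.v *)
Require Import Defs.
From Stdlib Require Import Reals.
From HB Require Import structures.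
From mathcomp Require Import all_boot all_order all_fingroup all_algebra all_field.
From mathcomp Require Import ring lra zify polyrcf Rstruct.
Set Implicit Arguments. Unset Strict Implicit. Unset Printing Implicit Defensive.
Import Order.TTheory GRing.Theory Num.Theory.

(** Indexing the positions by the field, eBCH(v,m) consists of the binary words
    [c] with [sum_x c(x) x^s = 0] for all [s <= v].  Hence it is invariant under
    the doubly transitive group of affine maps, its minimum weight exceeds
    [v + 1], and raising [v] by one costs at most [m] dimensions.

    Let [h(p)] be the probability that a fixed bit cannot be recovered from the
    other unerased bits; by transitivity it does not depend on the bit.  The
    derivative of the expected dimension of the subcode supported by the erased
    positions is [N h(p)], and [h] is nondecreasing, so [h(z) (1 - z)] is at most
    the rate, and [h(z)] stays away from 1 for [z < 1 - r].  By double
    transitivity all influences on [h] coincide, so the argument of Kahn, Kalai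
    and Linial (Bonami's lemma on the biased cube) gives
    [h' >= const * m * h (1 - h)]; two applications of the mean value theorem
    then give [h(p) = O(1/m^2)] for [p < 1 - r].

    If a nonzero codeword is supported by the erased positions, then at least
    [v + 2] erased bits are unrecoverable, so [(v + 2) P_B(p) <= N p h(p)].
    Since the rate is bounded away from 1, [N / v = O(m)], and [P_B(p) = O(1/m)]. *)

Local Open Scope ring_scope.

(** * Analysis on the biased cube *)

Section Biased.
Variables (R : comNzRingType) (T : finType).
Implicit Types (p : R) (E S : {set T}) (f g : {set T} -> R) (i : T).

(** The ring is arbitrary so that [p] can also be the indeterminate ['X]: expectations then become
    polynomials in [p] and can be differentiated. *)
Definition bmeas p E : R := \prod_i (if i \in E then p else 1 - p).
Definition Ex p f : R := \sum_E bmeas p E * f E.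
(** For the indicator of an increasing family, the mean of this discrete derivative is the influence
    of [i]. *)
Definition Dif i f E : R := f (i |: E) - f (E :\ i).
(** Centred but not divided by its standard deviation, which keeps square roots out; hence the
    powers of the variance [p (1 - p)] below. *)
Definition phi p i E : R := (i \in E)%:R - p.
Definition chi p S E : R := \prod_(i in S) phi p i E.

Lemma eq_Ex p f g : f =1 g -> Ex p f = Ex p g.
Proof. by move=> fg; apply: eq_bigr => E _; rewrite fg. Qed.

Lemma ExD p f g : Ex p (fun E => f E + g E) = Ex p f + Ex p g.
Proof. by rewrite /Ex -big_split; apply: eq_bigr => E _; rewrite mulrDr. Qed.

Lemma ExZ p a f : Ex p (fun E => a * f E) = a * Ex p f.
Proof. by rewrite /Ex mulr_sumr; apply: eq_bigr => E _; rewrite mulrCA. Qed.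

Lemma Ex_sum p (I : finType) (P : pred I) (F : I -> {set T} -> R) :
  Ex p (fun E => \sum_(k | P k) F k E) = \sum_(k | P k) Ex p (F k).
Proof.
rewrite /Ex exchange_big; apply: eq_bigr => E _; by rewrite mulr_sumr.
Qed.

Lemma Ex_prod p (u : T -> bool -> R) :
  Ex p (fun E => \prod_i u i (i \in E)) =
  \prod_i (p * u i true + (1 - p) * u i false).
Proof.
rewrite bigA_distr; apply: eq_bigr => E _.
rewrite /bmeas -big_split; apply: eq_bigr => i _ /=.
by case: (i \in E).
Qed.

Lemma bmeasE p E : bmeas p E = p ^+ #|E| * (1 - p) ^+ (#|T| - #|E|).
Proof.
rewrite /bmeas (bigID (mem E)) /= (eq_bigr (fun=> p)) => [|i ->] //.
rewrite [X in _ * X](eq_bigr (fun=> 1 - p)) => [|i /negbTE ->] //.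
rewrite !prodr_const; congr (_ * _ ^+ _).
by rewrite -(cardC (mem E)) addKn; apply: eq_card => i; rewrite !inE.
Qed.

Lemma Ex1 p : Ex p (fun=> 1) = 1.
Proof.
transitivity (Ex p (fun E => \prod_(i : T) 1)); first by apply: eq_Ex => E; rewrite big1.
by rewrite (Ex_prod p (fun _ _ => 1)) big1 // => i _; ring.
Qed.

Lemma Ex_cst p a : Ex p (fun=> a) = a.
Proof. by rewrite -[RHS]mulr1 -(Ex1 p) -ExZ; apply: eq_Ex => E; rewrite mulr1. Qed.

Lemma Ex_at0 f : Ex 0 f = f set0.
Proof.
rewrite /Ex (bigD1 set0) //= big1 => [|E EN0].
  by rewrite bmeasE cards0 expr0 mul1r subr0 expr1n mul1r addr0.
by rewrite bmeasE expr0n cards_eq0 (negbTE EN0) !mul0r.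
Qed.

(** Each [E] avoiding [i] is paired with [i |: E]; the leftover product is the measure on the other
    coordinates. *)
Lemma Ex_cond p i f :
  Ex p f = \sum_(E : {set T} | i \notin E)
   (\prod_(j | j != i) (if j \in E then p else 1 - p)) *
    (p * f (i |: E) + (1 - p) * f (E :\ i)).
Proof.
rewrite /Ex (bigID (fun E : {set T} => i \in E)) /=.
rewrite (reindex_onto (fun E => i |: E) (fun E => E :\ i)) /=; last first.
  by move=> E iE; rewrite setD1K.
rewrite (eq_bigl (fun E : {set T} => i \notin E)); last first.
  move=> E; rewrite setU11 /=; apply/eqP/idP => [<-|iE].
    by rewrite setD11.
  by rewrite setU1K.
rewrite -big_split; apply: eq_bigr => E iE /=.
have -> : E :\ i = E by apply/setP=> j; rewrite !inE; case: eqVneq => // ->; rewrite (negbTE iE).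
have -> : bmeas p (i |: E) = p * \prod_(j | j != i) (if j \in E then p else 1 - p).
  rewrite /bmeas (bigD1 i) //= setU11; congr (_ * _).
  by apply: eq_bigr => j ji; rewrite !inE (negbTE ji).
have -> : bmeas p E = (1 - p) * \prod_(j | j != i) (if j \in E then p else 1 - p).
  by rewrite /bmeas (bigD1 i) //= (negbTE iE).
ring.
Qed.

Lemma setU1U1 i E : i |: (i |: E) = i |: E. Proof. by rewrite setUA setUid. Qed.
Lemma setD1D1 i E : E :\ i :\ i = E :\ i. Proof. by rewrite setDDl setUid. Qed.
Lemma setU1D1 i E : i |: (E :\ i) = i |: E.
Proof. by apply/setP=> j; rewrite !inE; case: eqP. Qed.
Lemma setD1U1 i E : (i |: E) :\ i = E :\ i.
Proof. by apply/setP=> j; rewrite !inE; case: eqP. Qed.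

Lemma Ex_resample p i f :
  Ex p f = Ex p (fun E => p * f (i |: E) + (1 - p) * f (E :\ i)).
Proof.
rewrite (Ex_cond p i) [RHS](Ex_cond p i); apply: eq_bigr => E iE.
by congr (_ * _); rewrite setU1U1 setD1D1 setU1D1 setD1U1; ring.
Qed.

Definition indep i f := forall E, f (i |: E) = f E.

Lemma indepD1 i f E : indep i f -> f (E :\ i) = f E.
Proof. by move=> fi; rewrite -[LHS]fi setU1D1 fi. Qed.

Lemma Ex_indep p i (u : bool -> R) f : indep i f ->
  Ex p (fun E => u (i \in E) * f E) = (p * u true + (1 - p) * u false) * Ex p f.
Proof.
move=> fi; rewrite (Ex_resample p i) -ExZ; apply: eq_Ex => E.
by rewrite setU11 setD11 fi indepD1 //; ring.
Qed.

(** Integration by parts: averaging over coordinate [i] weights the two values of [f] by [p (1 - p)]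
    and its opposite. This links influences to Fourier coefficients. *)
Lemma Ex_phi p i f :
  Ex p (fun E => f E * phi p i E) = p * (1 - p) * Ex p (Dif i f).
Proof.
rewrite (Ex_resample p i) -ExZ; apply: eq_Ex => E.
by rewrite /phi /Dif setU11 setD11 /=; ring.
Qed.

Lemma chi0 p E : chi p set0 E = 1.
Proof. by rewrite /chi big_set0. Qed.

Lemma chi_indep p i S : i \notin S -> indep i (chi p S).
Proof.
move=> iS E; apply: eq_bigr => j jS; rewrite /phi !inE.
by case: eqVneq => // ji; rewrite -ji jS in iS.
Qed.

Lemma chiU1 p i S E : i \notin S -> chi p (i |: S) E = phi p i E * chi p S E.
Proof. by move=> iS; rewrite /chi big_setU1. Qed.

Lemma chi_prod p S E : chi p S E = \prod_i (if i \in S then phi p i E else 1).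
Proof. by rewrite /chi big_mkcond. Qed.

(** The mean factors over the coordinates; one lying in exactly one of the two sets contributes the
    mean of [phi], which is zero. *)
Lemma chi_orth p S S' :
  Ex p (fun E => chi p S E * chi p S' E) = (S == S')%:R * (p * (1 - p)) ^+ #|S|.
Proof.
pose u i (b : bool) : R := (if i \in S then b%:R - p else 1) * (if i \in S' then b%:R - p else 1).
rewrite (eq_Ex p (g := fun E => \prod_i u i (i \in E))); last first.
  by move=> E; rewrite !chi_prod -big_split.
rewrite Ex_prod (eq_bigr (fun i => if i \in S then (if i \in S' then p * (1 - p) else 0)
    else if i \in S' then 0 else 1)); last first.
  by move=> i _; rewrite /u; case: (i \in S); case: (i \in S') => /=; ring.
case: eqVneq => [<-|neq] /=.
  rewrite mul1r -prodr_const [RHS]big_mkcond /=.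
  by apply: eq_bigr => i _; case: (i \in S).
rewrite mul0r; have [i] : exists i, (i \in S) != (i \in S').
  apply/existsP; apply: contraR neq; rewrite negb_exists => /forallP h.
  by apply/eqP/setP => i; apply/eqP; have := h i; rewrite negbK.
move=> hi; rewrite (bigD1 i) //=; move: hi.
by case: (i \in S); case: (i \in S') => // _; rewrite mul0r.
Qed.
End Biased.

Section Positivity.
Variables (R : numDomainType) (T : finType) (p : R).
Hypotheses (p_ge0 : 0 <= p) (p_le1 : p <= 1).
Implicit Types (E : {set T}) (f g : {set T} -> R).

Lemma bmeas_ge0 E : 0 <= bmeas p E.
Proof. by apply: prodr_ge0 => i _; case: ifP => _; rewrite ?subr_ge0. Qed.

Lemma Ex_ge0 f : (forall E, 0 <= f E) -> 0 <= Ex p f.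
Proof. by move=> f0; apply: sumr_ge0 => E _; rewrite mulr_ge0 ?bmeas_ge0. Qed.

Lemma ler_Ex f g : (forall E, f E <= g E) -> Ex p f <= Ex p g.
Proof. by move=> fg; apply: ler_sum => E _; rewrite ler_wpM2l ?bmeas_ge0. Qed.
End Positivity.

(** * Fourier expansion, hypercontractivity and the KKL inequality *)

Section Fourier.
Variables (R : realFieldType) (T : finType) (p : R).
Hypotheses (p_gt0 : 0 < p) (p_lt1 : p < 1).
Implicit Types (E S A : {set T}) (f g : {set T} -> R) (i : T).
Local Notation E_ := (Ex p).
Local Notation s := (p * (1 - p)).

Lemma var_gt0 : 0 < s.
Proof. by rewrite mulr_gt0 // subr_gt0. Qed.

Local Notation Ex_ge0 := (Ex_ge0 (ltW p_gt0) (ltW p_lt1)).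
Local Notation ler_Ex := (ler_Ex (ltW p_gt0) (ltW p_lt1)).

(* From the nonnegativity of [E (E[g^2] f - E[fg] g)^2]. *)
Lemma Ex_CS f g : (E_ (fun E => f E * g E)) ^+ 2 <=
  E_ (fun E => f E ^+ 2) * E_ (fun E => g E ^+ 2).
Proof.
set a := E_ (fun E => f E ^+ 2); set c := E_ (fun E => g E ^+ 2).
set b := E_ _.
have a0 : 0 <= a by apply: Ex_ge0 => E; rewrite sqr_ge0.
have c0 : 0 <= c by apply: Ex_ge0 => E; rewrite sqr_ge0.
have H x y : 0 <= x ^+ 2 * a + 2 * x * y * b + y ^+ 2 * c.
  rewrite /a /b /c -!ExZ -!ExD; apply: Ex_ge0 => E.
  have -> : x ^+ 2 * f E ^+ 2 + 2 * x * y * (f E * g E) + y ^+ 2 * g E ^+ 2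
     = (x * f E + y * g E) ^+ 2 by ring.
  exact: sqr_ge0.
have [c_gt0|] := boolP (0 < c).
  have := H c (- b).
  have -> : c ^+ 2 * a + 2 * c * - b * b + (- b) ^+ 2 * c = c * (a * c - b ^+ 2) by ring.
  by rewrite pmulr_rge0 // subr_ge0.
rewrite lt_def c0 andbT negbK => /eqP c_0; rewrite c_0 mulr0.
have := H b (- (a + 1)); rewrite c_0 mulr0 addr0.
have -> : b ^+ 2 * a + 2 * b * - (a + 1) * b = - (b ^+ 2 * (a + 2)) by ring.
by rewrite oppr_ge0 pmulr_lle0 // ltr_wpDl.
Qed.

(** The factor compensates for the squared norm [s ^+ #|S|] of [chi p S], so that these are the
    coefficients of [f] in the characters. *)
Definition fcoef f S : R := s ^- #|S| * E_ (fun E => f E * chi p S E).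

(* The kernel [sum_S s^-|S| chi_S(E) chi_S(E')] is a product over the
   coordinates, and vanishes off the diagonal. *)
Lemma fourier_inversion f E : f E = \sum_(S : {set T}) fcoef f S * chi p S E.
Proof.
have ker E' : bmeas p E' * (\sum_(S : {set T}) s ^- #|S| * (chi p S E' * chi p S E)) = (E' == E)%:R.
  have -> : \sum_(S : {set T}) s ^- #|S| * (chi p S E' * chi p S E)
     = \prod_i (phi p i E' * phi p i E / s + 1).
    rewrite bigA_distr; apply: eq_bigr => S _.
    rewrite -big_mkcond /= big_split big_split /= prodr_const exprVn.
    by rewrite mulrC.
  rewrite /bmeas -big_split /=.
  have sN0 : s != 0 by rewrite gt_eqF ?var_gt0.
  have pN0 : p != 0 by rewrite gt_eqF.
  have qN0 : 1 - p != 0 by rewrite subr_eq0 gt_eqF.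
  rewrite (eq_bigr (fun i => ((i \in E') == (i \in E))%:R)); last first.
    move=> i _; rewrite /phi; case: (i \in E'); case: (i \in E) => /=; field; exact/andP.
  case: eqVneq => [->|neq]; first by rewrite big1 // => i _; rewrite eqxx.
  have [i hi] : exists i, (i \in E') != (i \in E).
    apply/existsP; apply: contraR neq; rewrite negb_exists => /forallP h.
    by apply/eqP/setP => i; apply/eqP; have := h i; rewrite negbK.
  by rewrite (bigD1 i) //= (negbTE hi) mul0r.
transitivity (\sum_(E' : {set T}) f E' * (E' == E)%:R).
  rewrite (bigD1 E) //= eqxx mulr1 big1 ?addr0 // => E' /negbTE ->.
  by rewrite mulr0.
transitivity (\sum_(E' : {set T}) \sum_(S : {set T}) s ^- #|S| * (bmeas p E' * (f E' * chi p S E')) * chi p S E).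
  apply: eq_bigr => E' _; rewrite -ker !mulr_sumr; apply: eq_bigr => S _; ring.
rewrite exchange_big; apply: eq_bigr => S _.
by rewrite /fcoef /Ex mulr_sumr mulr_suml.
Qed.

Lemma fcoefK f S : E_ (fun E => f E * chi p S E) = s ^+ #|S| * fcoef f S.
Proof. by rewrite /fcoef mulVKf // expf_neq0 // gt_eqF ?var_gt0. Qed.

Lemma parseval f : E_ (fun E => f E ^+ 2) = \sum_(S : {set T}) s ^+ #|S| * fcoef f S ^+ 2.
Proof.
transitivity (E_ (fun E => \sum_(S : {set T}) fcoef f S * (f E * chi p S E))).
  apply: eq_Ex => E; rewrite expr2 {2}(fourier_inversion f E) mulr_sumr.
  by apply: eq_bigr => S _; rewrite mulrCA.
by rewrite Ex_sum; apply: eq_bigr => S _; rewrite ExZ fcoefK; ring.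
Qed.

(** [Dif i f] does not depend on coordinate [i], so it is orthogonal to [chi p S] when [i] is in
    [S]; otherwise [Ex_phi] trades the derivative for a factor [phi]. *)
Lemma fcoef_Dif i f S :
  fcoef (Dif i f) S = if i \in S then 0 else fcoef f (i |: S).
Proof.
case: ifP => iS.
  rewrite /fcoef -[S in chi _ S](setD1K iS).
  under eq_Ex => E do rewrite chiU1 ?setD11 // mulrCA.
  rewrite (Ex_indep (i := i) p (fun b : bool => b%:R - p)) /=; last first.
    move=> E; rewrite /Dif setU1U1 setD1U1 (chi_indep p (i := i)) // setD11 //.
  have -> : p * (1 - p) + (1 - p) * (0 - p) = 0 by ring.
  by rewrite mul0r mulr0.
rewrite /fcoef cardsU1 iS add1n exprSr invfM.
under [in RHS]eq_Ex => E do rewrite chiU1 ?iS // mulrCA mulrC.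
rewrite Ex_phi.
have -> : E_ (Dif i (fun E => f E * chi p S E)) = E_ (fun E => Dif i f E * chi p S E).
  apply: eq_Ex => E; rewrite /Dif (indepD1 (i := i) _ (chi_indep p _)) ?iS //.
  by rewrite (chi_indep p (i := i)) ?iS // mulrBl.
have sN0 : s != 0 by rewrite gt_eqF ?var_gt0.
by rewrite -[RHS]mulrA mulKf.
Qed.

(* Induction on [A] through [P = g + phi_i h], with [g] and [h] independent of
   the coordinate [i], and [h] of smaller degree. *)
Lemma bonami (b : R) : 4 <= b -> 3 <= b ^+ 2 * s ->
  forall d A (c : {set T} -> R), (forall S, c S != 0 -> (S \subset A) && (#|S| <= d)%N) ->
  E_ (fun E => (\sum_(S : {set T}) c S * chi p S E) ^+ 4) <=
  b ^+ (2 * d) * (E_ (fun E => (\sum_(S : {set T}) c S * chi p S E) ^+ 2)) ^+ 2.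
Proof.
move=> b4 b2s d A; move: {2}#|A| (leqnn #|A|) => n.
have b1 : 1 <= b by lra.
have b0 : 0 <= b by lra.
elim: n d A => [|n IH] d A.
  rewrite leqn0 cards_eq0 => /eqP -> c hc.
  have cE E : \sum_(S : {set T}) c S * chi p S E = c set0.
    rewrite (bigD1 set0) //= chi0 mulr1 big1 ?addr0 // => S SN0.
    have [->|/hc] := eqVneq (c S) 0; first by rewrite mul0r.
    by rewrite subset0 (negbTE SN0).
  under eq_Ex => E do rewrite cE.
  under [in leRHS]eq_Ex => E do rewrite cE.
  rewrite !Ex_cst -exprM ler_peMl ?exprn_even_ge0 // exprn_ege1 //.
have [->|[i iA]] := set_0Vmem A; first by move=> _; apply: IH; rewrite cards0.
move=> cA c hc.
have cA' : (#|A :\ i| <= n)%N by move: cA; rewrite (cardsD1 i A) iA.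
pose c0 S := if i \in S then 0 else c S.
pose c1 S := if i \in S then 0 else c (i |: S).
pose g E := \sum_(S : {set T}) c0 S * chi p S E.
pose h E := \sum_(S : {set T}) c1 S * chi p S E.
have gi : indep i g.
  move=> E; apply: eq_bigr => S _; rewrite /c0; case: ifPn => iS; first by rewrite !mul0r.
  by rewrite chi_indep.
have hi : indep i h.
  move=> E; apply: eq_bigr => S _; rewrite /c1; case: ifPn => iS; first by rewrite !mul0r.
  by rewrite chi_indep.
have PE E : \sum_(S : {set T}) c S * chi p S E = g E + phi p i E * h E.
  rewrite (bigID (fun S : {set T} => i \in S)) /= addrC; congr (_ + _).
    rewrite big_mkcond; apply: eq_bigr => S _; rewrite /c0.
    by case: (i \in S); rewrite ?mul0r.
  rewrite mulr_sumr [RHS](bigID (fun S : {set T} => i \notin S)) /=.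
  rewrite [X in _ = _ + X]big1 ?addr0; last first.
    by move=> S; rewrite negbK /c1 => ->; rewrite mul0r mulr0.
  rewrite (reindex_onto (fun S => i |: S) (fun S => S :\ i)) /=; last first.
    by move=> S iS; rewrite setD1K.
  rewrite (eq_bigl (fun S : {set T} => i \notin S)); last first.
    move=> S; rewrite setU11 /=; apply/eqP/idP => [<-|iS].
      by rewrite setD11.
    by rewrite setU1K.
  apply: eq_bigr => S iS; rewrite chiU1 // /c1 (negbTE iS); ring.
have hc0 S : c0 S != 0 -> (S \subset A :\ i) && (#|S| <= d)%N.
  rewrite /c0; case: ifPn => [|iS /hc /andP[SA ->]]; first by rewrite eqxx.
  by rewrite subsetD1 SA iS.
have hc1 S : c1 S != 0 -> (S \subset A :\ i) && (#|S| < d)%N.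
  rewrite /c1; case: ifPn => [|iS /hc /andP[]]; first by rewrite eqxx.
  rewrite subUset => /andP[_ SA]; rewrite cardsU1 iS add1n => ->.
  by rewrite subsetD1 SA iS.
have IHg := IH d _ cA' _ hc0; rewrite -/g in IHg.
under eq_Ex => E do rewrite PE.
under [in leRHS]eq_Ex => E do rewrite PE.
(* In degree 0 the cofactor [h] vanishes; otherwise its degree is one less, and the induction
   hypothesis bounds it with a smaller exponent. *)
case: d => [|d] in hc hc0 hc1 IHg *.
  have h0 E : h E = 0.
    rewrite /h big1 // => S _.
    have [->|/hc1] := eqVneq (c1 S) 0; first by rewrite mul0r.
    by rewrite ltn0 andbF.
  under eq_Ex => E do rewrite h0 mulr0 addr0.
  by under [in leRHS]eq_Ex => E do rewrite h0 mulr0 addr0.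
have IHh := IH d _ cA' _ hc1; rewrite -/h in IHh.
set x := E_ (fun E => g E ^+ 2) in IHg.
set y := E_ (fun E => h E ^+ 2) in IHh.
have x0 : 0 <= x by apply: Ex_ge0 => E; rewrite sqr_ge0.
have y0 : 0 <= y by apply: Ex_ge0 => E; rewrite sqr_ge0.
have s0 := var_gt0.
(* Powers of [phi] factor out of the mixed moments. Their means are 0, [s], [s (1 - 2 p)] and
   [s (1 - 3 s)] for the exponents 1 to 4. *)
have Pm (k l : nat) (u : bool -> R) :
   E_ (fun E => u (i \in E) * (g E ^+ k * h E ^+ l)) =
    (p * u true + (1 - p) * u false) * E_ (fun E => g E ^+ k * h E ^+ l).
  by rewrite Ex_indep // => E; rewrite gi hi.
have g0 k : E_ (fun E => g E ^+ 0 * h E ^+ k) = E_ (fun E => h E ^+ k).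
  by apply: eq_Ex => E; rewrite expr0 mul1r.
have P2 : E_ (fun E => (g E + phi p i E * h E) ^+ 2) = x + s * y.
  transitivity (x + (E_ (fun E => (2 * ((i \in E)%:R - p)) * (g E ^+ 1 * h E ^+ 1))
     + E_ (fun E => ((i \in E)%:R - p) ^+ 2 * (g E ^+ 0 * h E ^+ 2)))).
    rewrite -!ExD; apply: eq_Ex => E; rewrite /phi; ring.
  rewrite (Pm 1%N 1%N (fun b => 2 * (b%:R - p))) (Pm 0%N 2%N (fun b => (b%:R - p) ^+ 2)) /=.
  rewrite g0 -/y; ring.
set z := E_ (fun E => g E ^+ 2 * h E ^+ 2).
have z0 : 0 <= z by apply: Ex_ge0 => E; rewrite mulr_ge0 // sqr_ge0.
(* Cauchy-Schwarz on the two inductive bounds; the exponent is the mean of [2 * d.+1] and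
   [2 * d]. *)
have hz : z <= b ^+ (2 * d).+1 * (x * y).
  rewrite -(@ler_pXn2r _ 2) ?nnegrE ?mulr_ge0 ?exprn_ge0 //.
  apply: le_trans (Ex_CS _ _) _.
  under eq_Ex => E do rewrite -exprM.
  under [X in _ * X <= _]eq_Ex => E do rewrite -exprM.
  have -> : (b ^+ (2 * d).+1 * (x * y)) ^+ 2 =
     (b ^+ (2 * d.+1) * x ^+ 2) * (b ^+ (2 * d) * y ^+ 2).
    rewrite !mulnS !exprS; ring.
  by apply: ler_pM => //; apply: Ex_ge0 => E; rewrite exprn_even_ge0.
set w := E_ (fun E => h E ^+ 4) in IHh.
have w0 : 0 <= w by apply: Ex_ge0 => E; rewrite exprn_even_ge0.
have P4 : E_ (fun E => (g E + phi p i E * h E) ^+ 4) <=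
   E_ (fun E => g E ^+ 4) + s * (8 * z + 3 * w).
  pose t := E_ (fun E => g E ^+ 1 * h E ^+ 3).
  (* The term in [g h^3] is absorbed by the two even ones; [a] will be [1 - 2 p], from the third
     moment. This turns the coefficients 6 and 1 into 8 and 3. *)
  have ht a : -1 <= a <= 1 -> a * t <= 2^-1 * (z + w).
    move=> /andP[a0 a1]; rewrite /t /z /w -ExD -!ExZ; apply: ler_Ex => E.
    have := sqr_ge0 (g E * h E - a * h E ^+ 2).
    have : 0 <= (1 - a ^+ 2) * h E ^+ 4.
      by rewrite mulr_ge0 ?exprn_even_ge0 //; nra.
    rewrite expr1; set G := g E; set H := h E; nra.
  have -> : E_ (fun E => (g E + phi p i E * h E) ^+ 4) = E_ (fun E => g E ^+ 4) +
     (s * 6 * z + s * (4 * ((1 - 2 * p) * t)) + s * ((1 - p) ^+ 3 + p ^+ 3) * w).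
    transitivity (E_ (fun E => g E ^+ 4) +
     (E_ (fun E => (4 * ((i \in E)%:R - p)) * (g E ^+ 3 * h E ^+ 1))
     + E_ (fun E => (6 * ((i \in E)%:R - p) ^+ 2) * (g E ^+ 2 * h E ^+ 2))
     + E_ (fun E => (4 * ((i \in E)%:R - p) ^+ 3) * (g E ^+ 1 * h E ^+ 3))
     + E_ (fun E => ((i \in E)%:R - p) ^+ 4 * (g E ^+ 0 * h E ^+ 4)))).
      rewrite -!ExD; apply: eq_Ex => E; rewrite /phi; ring.
    rewrite (Pm 3%N 1%N (fun b => 4 * (b%:R - p))) (Pm 2%N 2%N (fun b => 6 * (b%:R - p) ^+ 2)).
    rewrite (Pm 1%N 3%N (fun b => 4 * (b%:R - p) ^+ 3)) (Pm 0%N 4%N (fun b => (b%:R - p) ^+ 4)) /=.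
    rewrite g0 -/z -/t -/w; ring.
  rewrite lerD2l.
  have -> : s * 6 * z + s * (4 * ((1 - 2 * p) * t)) + s * ((1 - p) ^+ 3 + p ^+ 3) * w =
    s * (6 * z + 4 * ((1 - 2 * p) * t) + ((1 - p) ^+ 3 + p ^+ 3) * w) by ring.
  rewrite ler_pM2l //.
  have hp : -1 <= 1 - 2 * p <= 1 by move: p_gt0 p_lt1 => ? ?; apply/andP; split; lra.
  have h3 : (1 - p) ^+ 3 + p ^+ 3 <= 1.
    have -> : (1 - p) ^+ 3 + p ^+ 3 = 1 - 3 * s by ring.
    by rewrite gerBl mulr_ge0 // ltW.
  have := ler_wpM2r w0 h3; have := ht _ hp.
  lra.
apply: le_trans P4 _; rewrite P2.
set B := b ^+ (2 * d) in hz IHh *.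
have B0 : 0 <= B by rewrite exprn_ge0.
have e1 : b ^+ (2 * d.+1) = b ^+ 2 * B by rewrite mulnS exprD.
have e2 : b ^+ (2 * d).+1 = b * B by rewrite exprS.
rewrite e1 in IHg *; rewrite e2 in hz.
apply: le_trans (_ : b ^+ 2 * B * x ^+ 2 + s * (8 * (b * B * (x * y)) + 3 * (B * y ^+ 2)) <= _).
  apply: lerD => //; rewrite ler_pM2l //; lra.
rewrite -subr_ge0.
(* The two assumptions on [b] make both coefficients of this difference nonnegative. *)
have -> : b ^+ 2 * B * (x + s * y) ^+ 2 -
  (b ^+ 2 * B * x ^+ 2 + s * (8 * (b * B * (x * y)) + 3 * (B * y ^+ 2))) =
  s * B * (2 * b * (b - 4) * (x * y) + (b ^+ 2 * s - 3) * y ^+ 2) by ring.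
apply: mulr_ge0; first by rewrite mulr_ge0 // ltW.
by apply: addr_ge0; rewrite !mulr_ge0 ?subr_ge0 ?sqr_ge0.
Qed.

Lemma fcoef_set0 f : fcoef f set0 = E_ f.
Proof. by rewrite /fcoef cards0 expr0 invr1 mul1r; apply: eq_Ex => E; rewrite chi0 mulr1. Qed.

Lemma Ex_trunc f (Q : pred {set T}) :
  E_ (fun E => (\sum_(S : {set T}) (if Q S then fcoef f S else 0) * chi p S E) ^+ 2) =
  \sum_(S | Q S) s ^+ #|S| * fcoef f S ^+ 2.
Proof.
under eq_Ex => E do rewrite expr2 mulr_sumr.
rewrite Ex_sum [RHS]big_mkcond /=; apply: eq_bigr => S _.
under eq_Ex => E do rewrite mulrCA mulr_suml.
rewrite ExZ; case: ifP => QS; last by rewrite mul0r.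
rewrite Ex_sum (bigD1 S) //= big1 ?addr0; last first.
  move=> S' S'S; under eq_Ex => E do rewrite -mulrA.
  by rewrite ExZ chi_orth (negbTE S'S) mul0r mulr0.
under eq_Ex => E do rewrite -mulrA.
by rewrite ExZ chi_orth eqxx QS /=; ring.
Qed.

(* Bonami's lemma and two Cauchy-Schwarz inequalities in place of Hoelder's. *)
Lemma level_ineq (b : R) d g : 4 <= b -> 3 <= b ^+ 2 * s ->
  (forall E, g E ^+ 2 = g E) ->
  (\sum_(S : {set T} | (#|S| <= d)%N) s ^+ #|S| * fcoef g S ^+ 2) ^+ 2 <=
  E_ g ^+ 3 * b ^+ (2 * d).
Proof.
move=> b4 b2s gg; set W := \sum_(S | _) _.
have b0 : 0 <= b by lra.
have s0 := var_gt0.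
have W0 : 0 <= W by apply: sumr_ge0 => S _; rewrite mulr_ge0 ?sqr_ge0 // exprn_ge0 // ltW.
have g0 E : 0 <= g E by rewrite -gg sqr_ge0.
have Eg0 : 0 <= E_ g by exact: Ex_ge0.
pose c S := if (#|S| <= d)%N then fcoef g S else 0.
pose P E := \sum_(S : {set T}) c S * chi p S E.
have P2 : E_ (fun E => P E ^+ 2) = W by exact: Ex_trunc.
have gP : E_ (fun E => g E * P E) = W.
  under eq_Ex => E do rewrite mulr_sumr.
  rewrite Ex_sum /W [RHS]big_mkcond; apply: eq_bigr => S _.
  under eq_Ex => E do rewrite mulrCA.
  rewrite ExZ fcoefK /c; case: ifP => _; ring.
have P4 : E_ (fun E => P E ^+ 4) <= b ^+ (2 * d) * W ^+ 2.
  rewrite -P2; apply: (bonami b4 b2s (A := setT)) => S.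
  by rewrite /c subsetT; case: ifP => // _; rewrite eqxx.
have h1 : W ^+ 2 <= E_ g * E_ (fun E => g E * P E ^+ 2).
  rewrite -{1}gP; have := Ex_CS g (fun E => g E * P E).
  under [X in X ^+ 2 <= _]eq_Ex => E do rewrite mulrA -expr2 gg.
  under [X in _ <= X * _]eq_Ex => E do rewrite gg.
  by under [X in _ <= _ * X]eq_Ex => E do rewrite exprMn gg.
have h2 : E_ (fun E => g E * P E ^+ 2) ^+ 2 <= E_ g * E_ (fun E => P E ^+ 4).
  have := Ex_CS g (fun E => P E ^+ 2).
  under [X in _ <= X * _]eq_Ex => E do rewrite gg.
  by under [X in _ <= _ * X]eq_Ex => E do rewrite -exprM.
(* The inequalities combine to [W^4 <= (E g)^3 b^(2d) W^2], from which [W^2] is to be cancelled. *)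
have [->|WN0] := eqVneq W 0; first by rewrite expr0n /= mulr_ge0 ?exprn_ge0.
have W2 : 0 < W ^+ 2 by rewrite exprn_even_gt0.
rewrite -(ler_pM2r W2).
set X := E_ (fun E => g E * P E ^+ 2) in h1 h2.
have X0 : 0 <= X by apply: Ex_ge0 => E; rewrite mulr_ge0 ?sqr_ge0.
apply: le_trans (_ : (E_ g * X) ^+ 2 <= _).
  by rewrite -expr2 ler_pXn2r // nnegrE ?sqr_ge0 // mulr_ge0.
rewrite exprMn; apply: le_trans (ler_wpM2l (sqr_ge0 _) h2) _.
rewrite mulrA -exprSr -[leRHS]mulrA ler_wpM2l ?exprn_ge0 //.
Qed.

(** By [fcoef_Dif], a set [S] is counted once for each of its elements, and differentiation lowers
    the level by one. The predecessor is harmless at the empty set, where the factor [#|S|] is 0. *)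
Lemma Ex_Dif_sqr_low f d :
  \sum_i \sum_(S : {set T} | (#|S| <= d)%N) s ^+ #|S| * fcoef (Dif i f) S ^+ 2 =
  \sum_(S : {set T} | (#|S| <= d.+1)%N) #|S|%:R * (s ^+ #|S|.-1 * fcoef f S ^+ 2).
Proof.
have H i : \sum_(S : {set T} | (#|S| <= d)%N) s ^+ #|S| * fcoef (Dif i f) S ^+ 2 =
   \sum_(S : {set T} | (#|S| <= d.+1)%N && (i \in S)) s ^+ #|S|.-1 * fcoef f S ^+ 2.
  rewrite [RHS](reindex_onto (fun S => i |: S) (fun S => S :\ i)) /=; last first.
    by move=> S /andP[_ iS]; rewrite setD1K.
  rewrite [RHS](eq_bigl (fun S : {set T} => (#|S| <= d)%N && (i \notin S))); last first.
    move=> S; rewrite setU11 andbT cardsU1; have [iS|iS] /= := boolP (i \in S).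
      rewrite andbF; apply/negbTE; rewrite negb_and; apply/orP; right.
      by apply/eqP => h; move: iS; rewrite -h setD11.
    by rewrite setU1K // eqxx.
  rewrite [LHS](bigID (fun S : {set T} => i \notin S)) /= [X in _ + X]big1 ?addr0.
    by apply: eq_bigr => S /andP[_ iS]; rewrite fcoef_Dif (negbTE iS) cardsU1 iS.
  by move=> S /andP[_]; rewrite negbK fcoef_Dif => ->; rewrite expr0n mulr0.
under eq_bigr => i _ do rewrite H big_mkcondr.
rewrite exchange_big; apply: eq_bigr => S _.
by rewrite -big_mkcond /= sumr_const mulr_natl.
Qed.

Lemma Ex_Dif_sqr f :
  \sum_i E_ (fun E => Dif i f E ^+ 2) =
  \sum_(S : {set T}) #|S|%:R * (s ^+ #|S|.-1 * fcoef f S ^+ 2).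
Proof.
under eq_bigr => i _ do rewrite parseval.
transitivity (\sum_i \sum_(S : {set T} | (#|S| <= #|T|)%N) s ^+ #|S| * fcoef (Dif i f) S ^+ 2).
  by apply: eq_bigr => i _; apply: eq_bigl => S; rewrite max_card.
rewrite Ex_Dif_sqr_low; apply: eq_bigl => S.
by rewrite (leq_trans (max_card _)).
Qed.

Lemma variance_fcoef f :
  E_ (fun E => f E ^+ 2) - E_ f ^+ 2 = \sum_(S : {set T} | S != set0) s ^+ #|S| * fcoef f S ^+ 2.
Proof.
rewrite parseval (bigD1 set0) //= cards0 expr0 mul1r fcoef_set0.
by rewrite addrAC subrr add0r.
Qed.

(** The variance is split at level [d.+1]. Below, [level_ineq] and the bound [tau] make the
    low-degree weight of each derivative at most its mean divided by [d.+2]. Above, the total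
    influence counts each set at least [d.+2] times. Each half costs [s] times the total
    influence. *)
Theorem kkl_ineq (b : R) d f (tau : R) : 4 <= b -> 3 <= b ^+ 2 * s ->
  (forall i E, Dif i f E ^+ 2 = Dif i f E) ->
  (forall i, E_ (Dif i f) <= tau) ->
  tau * b ^+ (2 * d) * d.+2%:R ^+ 2 <= 1 ->
  d.+2%:R * (E_ (fun E => f E ^+ 2) - E_ f ^+ 2) <= 2 * s * \sum_i E_ (Dif i f).
Proof.
move=> b4 b2s DD Dtau htau.
have s0 := var_gt0; have s0W := ltW s0.
have b0 : 0 <= b by lra.
have D0 i : 0 <= E_ (Dif i f) by apply: Ex_ge0 => E; rewrite -DD sqr_ge0.
set k : R := d.+2%:R.
have k0 : 0 < k by rewrite ltr0n.
pose W i := \sum_(S : {set T} | (#|S| <= d)%N) s ^+ #|S| * fcoef (Dif i f) S ^+ 2.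
have W0 i : 0 <= W i by apply: sumr_ge0 => S _; rewrite mulr_ge0 ?sqr_ge0 ?exprn_ge0.
have hW i : k * W i <= E_ (Dif i f).
  rewrite -(@ler_pXn2r _ 2) ?nnegrE ?mulr_ge0 ?(ltW k0) // exprMn.
  apply: le_trans (ler_wpM2l (sqr_ge0 _) (level_ineq d b4 b2s (DD i))) _.
  set I := E_ (Dif i f); have I0 : 0 <= I := D0 i.
  have -> : k ^+ 2 * (I ^+ 3 * b ^+ (2 * d)) = I ^+ 2 * (I * b ^+ (2 * d) * k ^+ 2) by ring.
  rewrite -[leRHS]mulr1 ler_wpM2l ?sqr_ge0 //; apply: le_trans htau.
  by rewrite ler_wpM2r ?sqr_ge0 // ler_wpM2r ?exprn_ge0 ?Dtau.
have T2 : \sum_i E_ (Dif i f) = \sum_i E_ (fun E => Dif i f E ^+ 2).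
  by apply: eq_bigr => i _; apply: eq_Ex => E; rewrite DD.
have hWT : k * \sum_i W i <= \sum_i E_ (Dif i f).
  by rewrite mulr_sumr; apply: ler_sum => i _.
have sS S : S != set0 -> s ^+ #|S| * fcoef f S ^+ 2 = s * (s ^+ #|S|.-1 * fcoef f S ^+ 2).
  by rewrite -card_gt0 => S0; rewrite mulrA -exprS prednK.
have Y0 S : 0 <= s * (s ^+ #|S|.-1 * fcoef f S ^+ 2).
  by rewrite mulr_ge0 // mulr_ge0 ?sqr_ge0 // exprn_ge0.
rewrite variance_fcoef (bigID (fun S : {set T} => (#|S| <= d.+1)%N)) /= mulrDr.
have -> : 2 * s * \sum_i E_ (Dif i f) = s * \sum_i E_ (Dif i f) + s * \sum_i E_ (Dif i f) by ring.
apply: lerD.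
  apply: le_trans (_ : k * (s * \sum_i W i) <= _); last first.
    by rewrite mulrCA ler_pM2l.
  rewrite ler_pM2l // Ex_Dif_sqr_low mulr_sumr big_mkcondl /=.
  rewrite [leRHS]big_mkcond /= big_mkcond /=; apply: ler_sum => S _.
  case: (boolP (#|S| <= d.+1)%N) => // _.
    case: eqVneq => [->|SN0] /=; first by rewrite cards0 mul0r mulr0.
    by rewrite sS // [leRHS]mulrCA ler_peMl ?Y0 // ler1n card_gt0.
rewrite T2 Ex_Dif_sqr !mulr_sumr big_mkcond; apply: ler_sum => S _.
case: ifP => [/andP[SN0]|_]; last by rewrite [leRHS]mulrCA mulr_ge0 ?Y0.
by rewrite -ltnNge => dS; rewrite sS // [leRHS]mulrCA ler_wpM2r ?Y0 // ler_nat.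
Qed.
End Fourier.

(** * Russo's formula *)

Section Russo.
Variables (R : comNzRingType) (T : finType).
Implicit Types (E S : {set T}) (f g : {set T} -> R) (i : T).

Lemma deriv_prod (I : eqType) (r : seq I) (F : I -> {poly R}) : uniq r ->
  (\prod_(i <- r) F i)^`() = \sum_(i <- r) (F i)^`() * \prod_(j <- r | j != i) F j.
Proof.
elim: r => [|x r IH] /=; first by rewrite !big_nil derivC.
move=> /andP[xr /IH {}IH]; rewrite !big_cons eqxx /= derivM IH mulr_sumr; congr (_ + _).
  congr (_ * _); rewrite [RHS]big_seq_cond [LHS]big_seq; apply: eq_bigl => j.
  by have [jr|] //= := boolP (j \in r); apply/esym; apply: contraNneq xr => <-.
rewrite [LHS]big_seq [RHS]big_seq; apply: eq_bigr => i ir.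
rewrite big_cons ifT; first by rewrite mulrCA.
by apply: contraNneq xr => ->.
Qed.

(** The expectation as a polynomial in [p]: the mean value theorem for polynomials then applies to
    it. *)
Definition ExX f : {poly R} := Ex 'X (fun E => (f E)%:P).

Lemma horner_ExX f x : (ExX f).[x] = Ex x f.
Proof.
rewrite /ExX /Ex horner_sum; apply: eq_bigr => E _.
rewrite hornerM hornerC /bmeas horner_prod; congr (_ * _).
by apply: eq_bigr => i _; case: ifP => _; rewrite !hornerE.
Qed.

(** The factor of [bmeas] at [i] has derivative 1 or -1; pairing [E] with [i |: E] collects the two
    into [Dif i f]. *)
Lemma deriv_ExX f : (ExX f)^`() = \sum_i ExX (Dif i f).
Proof.
rewrite /ExX /Ex raddf_sum /=.
pose nu i E : {poly R} := \prod_(j | j != i) (if j \in E then 'X else 1 - 'X).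
transitivity (\sum_(E : {set T}) \sum_i (if i \in E then 1 else -1) * nu i E * (f E)%:P).
  apply: eq_bigr => E _; rewrite derivM derivC mulr0 addr0 -mulr_suml; congr (_ * _).
  rewrite /bmeas deriv_prod ?index_enum_uniq //; apply: eq_bigr => i _; congr (_ * _).
  by case: ifP => _; rewrite ?derivB ?derivX ?derivC ?sub0r.
rewrite exchange_big; apply: eq_bigr => i _; rewrite -/(Ex 'X _) (Ex_cond 'X i).
rewrite (bigID (fun E : {set T} => i \in E)) /=.
rewrite (reindex_onto (fun E => i |: E) (fun E => E :\ i)) /=; last first.
  by move=> E iE; rewrite setD1K.
rewrite (eq_bigl (fun E : {set T} => i \notin E)); last first.
  move=> E; rewrite setU11 /=; apply/eqP/idP => [<-|iE].
    by rewrite setD11.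
  by rewrite setU1K.
rewrite -big_split; apply: eq_bigr => E iE /=.
have Ei : E :\ i = E by apply/setP=> j; rewrite !inE; case: eqVneq => // ->; rewrite (negbTE iE).
have -> : nu i (i |: E) = nu i E.
  by apply: eq_bigr => j ji; rewrite !inE (negbTE ji).
rewrite /Dif setU11 (negbTE iE) setU1U1 setD1U1 !setU1D1 !Ei -/(nu i E) !polyCB.
ring.
Qed.
End Russo.

(** * Linear codes on the erasure channel *)

Section Code.
Variables (T : finType) (C : {set {ffun T -> 'F_2}}).
Implicit Types (E : {set T}) (i j : T) (c : {ffun T -> 'F_2}).
Hypotheses (C0 : 0 \in C) (CD : forall c c', c \in C -> c' \in C -> c + c' \in C).

Definition supp c : {set T} := [set i | c i != 0].

(* Bit [i] cannot be recovered when the positions in [i |: E] are erased. *)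
Definition unrecoverable i E : bool := [exists c in C, (c i != 0) && (supp c \subset i |: E)].

Definition undecodable E : bool := [exists c in C, (c != 0) && (supp c \subset E)].

Definition subcode E : {set {ffun T -> 'F_2}} := [set c in C | supp c \subset E].

Lemma F2P (x : 'F_2) : x != 0 -> x = 1.
Proof. by case: x => [[|[|[]]]] //= h _; apply/val_inj. Qed.

Lemma unrecoverable_mono i E E' : E \subset E' -> unrecoverable i E -> unrecoverable i E'.
Proof.
move=> EE' /exists_inP[c cC /andP[ci cE]]; apply/exists_inP; exists c => //.
by rewrite ci (subset_trans cE) // setUS.
Qed.

(** If a codeword supported by [i |: E] has bit [i] set, translation by it exchanges the words with
    bit [i] clear and those with bit [i] set; otherwise the two subcodes agree. *)
Lemma card_subcode i E : i \notin E ->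
  #|subcode (i |: E)| = (#|subcode E| * 2 ^ unrecoverable i E)%N.
Proof.
move=> iE; have sub : subcode E \subset subcode (i |: E).
  apply/subsetP => c; rewrite !inE => /andP[-> cE] /=.
  by rewrite (subset_trans cE) // subsetUr.
have eqE c : supp c \subset i |: E -> c i = 0 -> supp c \subset E.
  move=> cE ci; apply/subsetP => j jc; have := subsetP cE _ jc.
  by rewrite !inE => /orP[/eqP ji|//]; move: jc; rewrite inE ji ci eqxx.
case: (boolP (unrecoverable i E)) => [/exists_inP[c0 c0C /andP[c0i c0E]]|om] /=; last first.
  rewrite muln1; congr #|pred_of_set _|; apply/eqP; rewrite eqEsubset sub andbT.
  apply/subsetP => c; rewrite !inE => /andP[cC cE]; rewrite cC /=.
  apply: eqE => //; apply/eqP; apply: contraR om => ci.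
  by apply/exists_inP; exists c => //; rewrite ci cE.
have subD c : supp c \subset i |: E -> supp (c + c0) \subset i |: E.
  move=> cE; apply/subsetP => j; rewrite inE ffunE => jc.
  have [cj|cj] := eqVneq (c j) 0; last by apply: (subsetP cE); rewrite inE.
  by apply: (subsetP c0E); rewrite inE; move: jc; rewrite cj add0r.
pose t c : {ffun T -> 'F_2} := c + c0.
have inj : injective t by apply: addIr.
have -> : subcode (i |: E) = subcode E :|: t @: subcode E.
  apply/eqP; rewrite eqEsubset subUset sub; apply/and3P; split => //; last first.
    apply/subsetP => _ /imsetP[c + ->]; rewrite !inE => /andP[cC cE].
    rewrite /t CD //= subD // (subset_trans cE) // subsetUr //.
  apply/subsetP => c; rewrite !inE => /andP[cC cE]; rewrite cC /=.
  have [ci|ci] := eqVneq (c i) 0; first by rewrite eqE.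
  apply/orP; right; apply/imsetP; exists (t c).
    rewrite inE CD //= eqE ?subD // ffunE (F2P ci) (F2P c0i); exact/val_inj.
  by rewrite /t -addrA; apply/ffunP => j; rewrite !ffunE; case: (c0 j) => [[|[|[]]]] //= ?;
    rewrite -[LHS]addr0; congr (_ + _); apply/val_inj.
rewrite cardsU card_imset // disjoint_setI0 ?cards0 ?subn0; first by rewrite addnn -muln2.
rewrite disjoints_subset; apply/subsetP => c; rewrite !inE => /andP[_ cE].
apply/imsetP => -[c']; rewrite inE => /andP[_ c'E] ec.
have z (c1 : {ffun T -> 'F_2}) : supp c1 \subset E -> c1 i = 0.
  by move=> s; apply/eqP; apply: contraNT iE => h; apply: (subsetP s); rewrite inE.
have := z _ cE; rewrite ec /t ffunE (z _ c'E) add0r => h; by rewrite h eqxx in c0i.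
Qed.

Lemma supp_eq0 c : (supp c \subset set0) = (c == 0).
Proof.
apply/idP/eqP => [h|->]; last by apply/subsetP => j; rewrite inE ffunE eqxx.
by apply/ffunP => j; rewrite ffunE; apply/eqP; apply: contraTT h => h;
  apply/subsetPn; exists j; rewrite !inE.
Qed.

Lemma undecodable_set0 : undecodable set0 = false.
Proof.
apply/negbTE; rewrite negb_exists_in; apply/forall_inP => c _.
by rewrite supp_eq0 andNb.
Qed.

(** Positions are added one at a time, each multiplying the size by 1 or 2. This is why [logn 2] can
    serve as the dimension. *)
Lemma card_subcode_pow2 E : #|subcode E| = (2 ^ logn 2 #|subcode E|)%N.
Proof.
suff [k ->] : exists k, #|subcode E| = (2 ^ k)%N by rewrite pfactorK.
have [n] := ubnP #|E|; elim: n E => // n IH E hE.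
have [->|[i iE]] := set_0Vmem E.
  exists 0%N; apply/eqP/cards1P; exists 0; apply/setP => c.
  by rewrite !inE supp_eq0; case: eqVneq => [->|_]; rewrite ?C0 ?andbF.
rewrite -(setD1K iE) card_subcode ?setD11 //.
have [|k ->] := IH (E :\ i); first by move: hE; rewrite (cardsD1 i E) iE; lia.
by exists (k + unrecoverable i (E :\ i))%N; rewrite expnD.
Qed.

Lemma subcodeT : subcode setT = C.
Proof. by apply/setP => c; rewrite inE subsetT andbT. Qed.

Lemma card_code_pow2 : #|C| = (2 ^ logn 2 #|C|)%N.
Proof. by have := card_subcode_pow2 setT; rewrite subcodeT. Qed.

Section Channel.
Variable R : rcfType.
Implicit Types (p x : R).

Definition unrec i E : R := (unrecoverable i E)%:R.
Definition sdim E : R := (logn 2 #|subcode E|)%:R.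

Lemma Dif_sdim i E : Dif i sdim E = unrec i E.
Proof.
rewrite /Dif /sdim -(setU1D1 i E) card_subcode ?setD11 //.
have c0 : (0 < #|subcode (E :\ i)|)%N by rewrite card_subcode_pow2 expn_gt0.
rewrite lognM ?expn_gt0 // pfactorK // natrD addrAC subrr add0r /unrec.
by rewrite /unrecoverable setU1D1.
Qed.

Lemma sdim_le E : sdim E <= (logn 2 #|C|)%:R.
Proof.
rewrite ler_nat -(@leq_exp2l 2) // -card_code_pow2 -card_subcode_pow2.
by apply: subset_leq_card; apply/subsetP => c; rewrite inE => /andP[].
Qed.

Lemma unrec_indep i : indep i (unrec i).
Proof. by move=> E; rewrite /unrec /unrecoverable setU1U1. Qed.

Lemma Dif_unrec_self i E : Dif i (unrec i) E = 0.
Proof. by rewrite /Dif unrec_indep (indepD1 _ (unrec_indep i)) subrr. Qed.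

Lemma Dif_unrec_idem i j E : Dif j (unrec i) E ^+ 2 = Dif j (unrec i) E.
Proof.
rewrite /Dif /unrec.
have := @unrecoverable_mono i (E :\ j) (j |: E) (subset_trans (subD1set _ _) (subsetUr _ _)).
by case: (unrecoverable i (E :\ j)) => [->|_] //; case: (unrecoverable i (j |: E)) => //=; ring.
Qed.

Lemma Dif_unrec_ge0 i j E : 0 <= Dif j (unrec i) E.
Proof. by rewrite -Dif_unrec_idem sqr_ge0. Qed.

(** The EXIT function of bit [i], a polynomial in [x]. *)
Definition exit i x : R := Ex x (unrec i).

Lemma exit_ge0 i x : 0 <= x <= 1 -> 0 <= exit i x.
Proof. by case/andP=> x0 x1; apply: Ex_ge0 => // E; rewrite ler0n. Qed.

Lemma exit_mvt i x y : x < y -> exists2 z, x < z < y &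
  exit i y - exit i x = (\sum_j Ex z (Dif j (unrec i))) * (y - x).
Proof.
move=> xy; have [z] := poly_mvt (ExX (unrec i)) xy.
rewrite in_itv /= => hz; rewrite !horner_ExX deriv_ExX horner_sum => e.
by exists z => //; rewrite /exit e; congr (_ * _); apply: eq_bigr => j _; rewrite horner_ExX.
Qed.

Lemma exit_mono i x y : 0 <= x -> x <= y -> y <= 1 -> exit i x <= exit i y.
Proof.
move=> x0; rewrite le_eqVlt => /orP[/eqP->//|xy] y1.
have [z /andP[xz zy] e] := exit_mvt i xy.
rewrite -subr_ge0 e mulr_ge0 ?subr_ge0 ?(ltW xy) // sumr_ge0 // => j _.
by apply: Ex_ge0 => [||E]; [lra|lra|exact: Dif_unrec_ge0].
Qed.

(* The derivative of the expected dimension of the subcode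
   supported by the erasures is the sum of the EXIT functions. *)
Lemma area_theorem (h : R -> R) x : (forall i y, exit i y = h y) -> 0 <= x < 1 ->
  #|T|%:R * h x * (1 - x) <= (logn 2 #|C|)%:R.
Proof.
move=> hE /andP[x0 x1].
(* The mean value theorem on [[x, 1]] replaces the integral of the EXIT function, and monotonicity
   moves the intermediate point [z] back to [x]. *)
have [z] := poly_mvt (ExX sdim) x1; rewrite in_itv /= => /andP[xz z1].
rewrite !horner_ExX deriv_ExX horner_sum => e.
have d0 : 0 <= Ex x sdim by apply: Ex_ge0 => [||E]; rewrite ?ler0n // ltW.
have d1 : Ex 1 sdim <= (logn 2 #|C|)%:R.
  rewrite -[leRHS](Ex_cst T 1); apply: ler_Ex => // E; exact: sdim_le.
have e2 : \sum_i (ExX (Dif i sdim)).[z] = #|T|%:R * h z.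
  rewrite (eq_bigr (fun=> h z)) => [|i _]; first by rewrite sumr_const mulr_natl.
  by rewrite horner_ExX -(hE i); apply: eq_Ex => E; rewrite Dif_sdim.
have hm : #|T|%:R * h x <= #|T|%:R * h z.
  have [i _|T0] := pickP T; last by rewrite (eq_card0 T0) !mul0r.
  by rewrite ler_wpM2l ?ler0n // -!(hE i) exit_mono // ltW.
have := ler_wpM2r (_ : 0 <= 1 - x) hm; rewrite subr_ge0 (ltW x1) => /(_ isT).
rewrite e2 in e; lra.
Qed.

(** The right-hand side is the expected number of erased unrecoverable bits, since [unrec i] is
    independent of the erasure of [i]. The support of a nonzero codeword inside [E] consists of such
    bits. *)
Lemma undecodable_exit (d : nat) (h : R -> R) x : (forall i y, exit i y = h y) ->
  (forall c, c \in C -> c != 0 -> (d <= #|supp c|)%N) -> 0 <= x <= 1 ->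
  d%:R * Ex x (fun E => (undecodable E)%:R) <= #|T|%:R * (x * h x).
Proof.
move=> hE hd /andP[x0 x1].
have -> : #|T|%:R * (x * h x) = \sum_i Ex x (fun E => (i \in E)%:R * unrec i E).
  rewrite (eq_bigr (fun=> x * h x)) => [|i _]; first by rewrite sumr_const mulr_natl.
  rewrite (Ex_indep x (fun b : bool => b%:R) (unrec_indep i)) /=.
  by rewrite -/(exit i x) hE mulr1 mulr0 addr0.
rewrite -ExZ -Ex_sum; apply: ler_Ex => // E.
case: (boolP (undecodable E)) => [|_]; last first.
  by rewrite mulr0; apply: sumr_ge0 => i _; rewrite mulr_ge0 ?ler0n.
move=> /exists_inP[c cC /andP[cN0 cE]]; rewrite mulr1.
apply: le_trans (_ : #|supp c|%:R <= _); first by rewrite ler_nat hd.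
rewrite -sumr_const big_mkcond /=; apply: ler_sum => i _.
case: ifP => [ic|_]; last by rewrite mulr_ge0 ?ler0n.
rewrite (subsetP cE) // mul1r /unrec ler1n lt0b; apply/exists_inP; exists c => //.
by move: ic; rewrite inE => -> /=; rewrite (subset_trans cE) // subsetUr.
Qed.

End Channel.
End Code.

Lemma Ex_perm (R : comNzRingType) (T : finType) (s : {perm T}) (p : R) (f : {set T} -> R) :
  Ex p (fun E => f (s @: E)) = Ex p f.
Proof.
rewrite /Ex [RHS](reindex_inj (imset_inj (@perm_inj _ s))) /=.
by apply: eq_bigr => E _; rewrite !bmeasE card_imset //; apply: perm_inj.
Qed.

(** * Codes with a doubly transitive automorphism group *)

Section DoublyTransitive.
Variables (T : finType) (C : {set {ffun T -> 'F_2}}).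
Implicit Types (E : {set T}) (i j : T) (c : {ffun T -> 'F_2}).
Hypotheses (C0 : 0 \in C) (CD : forall c c', c \in C -> c' \in C -> c + c' \in C).

Definition code_aut (s : {perm T}) := forall c, ([ffun x => c (s x)] \in C) = (c \in C).

Hypothesis C_trans2 : forall i j k l, i != j -> k != l ->
  exists2 s : {perm T}, code_aut s & s i = k /\ s j = l.
Hypothesis T_gt1 : (1 < #|T|)%N.

Lemma exists_neq i : exists j, j != i.
Proof.
have [j ji|h] := pickP (predC1 i); first by exists j.
have := cardC1 i; rewrite (eq_card0 h); by case: #|T| T_gt1 => [|[]].
Qed.

Lemma imset_supp (s : {perm T}) c E i :
  (supp c \subset s i |: s @: E) = (supp [ffun x => c (s x)] \subset i |: E).
Proof.
have -> : s i |: s @: E = s @: (i |: E) by rewrite imsetU1.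
apply/subsetP/subsetP => h x; rewrite inE => cx.
  move: cx; rewrite ffunE => cx; have := h (s x); rewrite inE cx => /(_ isT).
  by rewrite (mem_imset _ _ (@perm_inj _ s)).
rewrite -(permKV s x) (mem_imset _ _ (@perm_inj _ s)).
by apply: h; rewrite inE ffunE permKV.
Qed.

Lemma unrecoverable_perm s i E : code_aut s -> unrecoverable C (s i) (s @: E) = unrecoverable C i E.
Proof.
move=> sC; apply/exists_inP/exists_inP => -[c cC /andP[ci cE]].
  exists [ffun x => c (s x)]; first by rewrite sC.
  by rewrite ffunE ci -imset_supp.
have e : [ffun x => [ffun y => c ((s^-1)%g y)] (s x)] = c.
  by apply/ffunP => x; rewrite !ffunE permK.
exists [ffun y => c ((s^-1)%g y)]; first by rewrite -sC e.
by rewrite imset_supp e cE ffunE permK ci.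
Qed.

Section Bound.
Variable R : rcfType.
Implicit Types x y : R.

Lemma exit_eq i j x : exit C i x = exit C j x.
Proof.
have [k ki] := exists_neq i; have [l lj] := exists_neq j.
rewrite eq_sym in ki; rewrite eq_sym in lj.
have [s sC [sij _]] := C_trans2 ki lj.
rewrite /exit -(Ex_perm s x (unrec C R j)); apply: eq_Ex => E.
by rewrite /unrec -sij unrecoverable_perm.
Qed.

Lemma imset_setD1 (s : {perm T}) E j : s @: (E :\ j) = s @: E :\ s j.
Proof.
apply/setP => x; rewrite -(permKV s x) !inE !(mem_imset _ _ (@perm_inj _ s)) !inE.
by rewrite (inj_eq perm_inj).
Qed.

(** Double transitivity supplies an automorphism that fixes [i] and sends [j] to [k]. *)
Lemma influence_eq i j k x : j != i -> k != i ->
  Ex x (Dif j (unrec C R i)) = Ex x (Dif k (unrec C R i)).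
Proof.
move=> ji ki; have [s sC [sjk sii]] := C_trans2 ji ki.
rewrite -(Ex_perm s x (Dif k _)); apply: eq_Ex => E.
rewrite /Dif /unrec -sjk -imset_setD1 -imsetU1.
by rewrite -(unrecoverable_perm _ _ sC) -(unrecoverable_perm _ (E :\ j) sC) sii.
Qed.

(* Either the common influence is so large that the total influence is huge,
   or the KKL inequality applies. *)
Lemma exit_deriv_ge (b : R) d i x : 0 < x -> x < 1 -> 4 <= b -> 3 <= b ^+ 2 * (x * (1 - x)) ->
  b ^+ (2 * d) * d.+2%:R ^+ 3 <= #|T|.-1%:R ->
  d.+2%:R * (exit C i x * (1 - exit C i x)) <= \sum_j Ex x (Dif j (unrec C R i)).
Proof.
move=> x0 x1 b4 b2s hN.
have [k ki] := exists_neq i.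
pose tau := Ex x (Dif k (unrec C R i)).
have D0 j : 0 <= Ex x (Dif j (unrec C R i)).
  by apply: Ex_ge0 => [||E]; [exact: ltW|exact: ltW|exact: Dif_unrec_ge0].
have Di : Ex x (Dif i (unrec C R i)) = 0.
  by rewrite -(Ex_cst T x 0); apply: eq_Ex => E; rewrite Dif_unrec_self.
have sumE : \sum_j Ex x (Dif j (unrec C R i)) = #|T|.-1%:R * tau.
  rewrite (bigD1 i) //= Di add0r (eq_bigr (fun=> tau)) => [|j ji]; last exact: influence_eq.
  by rewrite sumr_const cardC1 mulr_natl.
have Dtau j : Ex x (Dif j (unrec C R i)) <= tau.
  have [->|ji] := eqVneq j i; first by rewrite Di D0.
  by rewrite (influence_eq x ji ki).
set h := exit C i x; set S := \sum_j _.
set n : R := d.+2%:R; have n0 : 0 < n by rewrite ltr0n.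
set B := b ^+ (2 * d) in hN; have B0 : 0 <= B by rewrite exprn_ge0 //; lra.
have tau0 : 0 <= tau := D0 k.
have sq : Ex x (fun E => unrec C R i E ^+ 2) = h.
  by apply: eq_Ex => E; rewrite /unrec; case: (unrecoverable C i E); rewrite ?expr1n ?expr0n.
have [small|large] := leP (tau * B * n ^+ 2) 1.
  have := kkl_ineq x0 x1 b4 b2s (Dif_unrec_idem C R i) Dtau small.
  rewrite sq -/h -/n -/S => hk.
  have S0 : 0 <= S by apply: sumr_ge0.
  have -> : h * (1 - h) = h - h ^+ 2 by ring.
  apply: le_trans hk _; rewrite -[leRHS]mul1r ler_wpM2r //.
  have := sqr_ge0 (2 * x - 1); nra.
(* Here [tau * B * n^2 > 1], so the total influence [(N - 1) tau >= B n^3 tau] exceeds [n], while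
   [h (1 - h) <= 1]. *)
rewrite /S sumE; apply: le_trans (_ : n * 1 <= _).
  rewrite ler_pM2l //; have := sqr_ge0 (2 * h - 1); nra.
apply: le_trans (_ : n * (tau * B * n ^+ 2) <= _); first by rewrite ler_pM2l // ltW.
have -> : n * (tau * B * n ^+ 2) = (B * n ^+ 3) * tau by ring.
by rewrite ler_wpM2r.
Qed.

(** The window from [x] to [x + 2 dl] is crossed in two steps, and each gains a factor [n eta dl]
    with [n = d.+2]. One step would give [h = O(1/m)], which the factor [N / dmin] of order [m]
    would cancel. *)
Theorem undecodable_bound (b x dl eta r : R) d dmin :
  0 < x -> 0 < dl -> x + 2 * dl < 1 -> 0 < eta ->
  4 <= b -> 3 <= b ^+ 2 * (x * (1 - (x + 2 * dl))) ->
  b ^+ (2 * d) * d.+2%:R ^+ 3 <= #|T|.-1%:R ->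
  (logn 2 #|C|)%:R <= r * #|T|%:R -> r <= (1 - eta) * (1 - (x + 2 * dl)) ->
  (forall c, c \in C -> c != 0 -> (dmin <= #|supp c|)%N) ->
  (d.+2%:R * eta * dl) ^+ 2 * (dmin%:R * Ex x (fun E => (undecodable C E)%:R)) <= #|T|%:R.
Proof.
move=> x0 dl0 z1 eta0 b4 b2s hN hK hr hd.
have [i _] : exists i : T, i \in T by apply/card_gt0P/ltnW.
pose h := exit C i (R := R).
have hE j y : exit C j y = h y by exact: exit_eq.
set z := x + 2 * dl in z1 b2s hr.
have N0 : 0 < #|T|%:R :> R by rewrite ltr0n ltnW.
have hz : h z <= 1 - eta.
  have zI : 0 <= z < 1 by apply/andP; split=> //; rewrite /z; lra.
  have := area_theorem C0 CD hE zI => ha.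
  have z1' : 0 < 1 - z by lra.
  rewrite -(ler_pM2r z1') -(ler_pM2l N0) mulrA.
  apply: (le_trans ha); apply: (le_trans hK).
  by rewrite mulrC ler_pM2l.
have hm y y' : x <= y -> y <= y' -> y' <= z -> h y <= h y'.
  by move=> *; apply: exit_mono => //; lra.
have h0 y : x <= y -> y <= z -> 0 <= h y.
  by move=> *; apply: exit_ge0; apply/andP; split; lra.
set n : R := d.+2%:R in hN *; have n0 : 0 < n by rewrite ltr0n.
(* At the intermediate point [w], both [h w >= h y] and [1 - h w >= eta], so the derivative is at
   least [n * h y * eta]. *)
have step y : x <= y -> y + dl <= z -> n * eta * dl * h y <= h (y + dl).
  move=> xy yz; have [|w /andP[yw wz]] := @exit_mvt T C R i y (y + dl); first by lra.
  have -> : y + dl - y = dl by ring.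
  rewrite -/(h _) -/(h y) => e.
  have hw : h w <= 1 - eta by apply: le_trans hz; apply: hm; lra.
  have hwy : h y <= h w by apply: hm; lra.
  have hy0 : 0 <= h y by apply: h0; lra.
  have w0 : 0 < w by lra.
  have w1 : w < 1 by lra.
  (* On the window [w (1 - w) >= x (1 - z)], so a single [b] serves everywhere. *)
  have b2w : 3 <= b ^+ 2 * (w * (1 - w)).
    apply: (le_trans b2s); rewrite ler_wpM2l ?sqr_ge0 //.
    by apply: ler_pM; lra.
  have := exit_deriv_ge i w0 w1 b4 b2w hN; rewrite -/n -/(h w).
  move: e; set S := \sum_j _ => e hS.
  have h1 : n * (h y * eta) <= n * (h w * (1 - h w)).
    by rewrite ler_pM2l //; apply: ler_pM; lra.
  have h2 : n * (h y * eta) * dl <= S * dl by rewrite ler_pM2r // (le_trans h1).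
  have e1 : n * eta * dl * h y = n * (h y * eta) * dl by ring.
  lra.
have s1 : n * eta * dl * h x <= h (x + dl) by apply: step; rewrite /z; lra.
have s2 : n * eta * dl * h (x + dl) <= h (x + dl + dl) by apply: step; rewrite /z; lra.
have hx1 : (n * eta * dl) ^+ 2 * h x <= 1.
  rewrite expr2 -mulrA; apply: le_trans (_ : n * eta * dl * h (x + dl) <= _).
    by rewrite ler_pM2l // !mulr_gt0.
  apply: (le_trans s2); apply: (le_trans (y := h z)); last by lra.
  by apply: hm; rewrite /z; lra.
have xI : 0 <= x <= 1 by apply/andP; split; rewrite /z in z1; lra.
have := undecodable_exit hE hd xI => hu.
apply: le_trans (ler_wpM2l (sqr_ge0 _) hu) _.
rewrite mulrCA -[leRHS]mulr1 ler_pM2l //; apply: le_trans hx1.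
rewrite ler_wpM2l ?sqr_ge0 // ler_piMl //; first by apply: h0; rewrite /z; lra.
by case/andP: xI.
Qed.
End Bound.
End DoublyTransitive.

(** * Extended BCH codes *)

Lemma big_ord_widen_last (V : nmodType) n (F : 'I_n -> V) (i0 : 'I_n) : nat_of_ord i0 = n.-1 ->
  \sum_i F i = \sum_(i < n - 1) F (widen_ord (leq_subr 1 n) i) + F i0.
Proof.
case: n F i0 => [|n] F i0; first by case: i0.
move: (leq_subr 1 n.+1); rewrite subn1 => le /= i0n; rewrite big_ord_recr /=.
by congr (_ + F _); [apply: eq_bigr => i _; congr F|]; apply: val_inj.
Qed.

Section BCHcode.
Variables (F : finFieldType) (alpha : F) (m : nat).
Hypotheses (m_gt0 : (0 < m)%N) (cardF : #|F| = (2 ^ m)%N)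
  (alpha_prim : primitive_root_of_unity (2 ^ m - 1) alpha).
Local Notation N := (2 ^ m)%N.
Local Notation word := {ffun 'I_N -> 'F_2}.
Implicit Types (y : word) (i : 'I_N) (k : nat).

Lemma pcharF2 : 2 \in [pchar F].
Proof. exact: (card_finPcharP cardF). Qed.

Lemma emb2_zmod : zmod_morphism (emb2 F).
Proof.
have F2 : 1 + 1 = 0 :> F by have := pcharf0 pcharF2; rewrite mulr2n.
move=> [[|[|[]]] // ?] [[|[|[]]] // ?]; rewrite /emb2 /= ?subrr ?subr0 ?sub0r //.
by rewrite modn_small // mulr1n; apply/eqP; rewrite -subr_eq0 opprK F2.
Qed.

Lemma emb2_monoid : monoid_morphism (emb2 F).
Proof.
split; first by [].
by move=> [[|[|[]]] // ?] [[|[|[]]] // ?]; rewrite /emb2 /= ?mul0r ?mulr0 ?mulr1.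
Qed.

Definition emb : {rmorphism 'F_2 -> F} :=
  HB.pack (emb2 F) (GRing.isZmodMorphism.Build _ _ _ emb2_zmod)
    (GRing.isMonoidMorphism.Build _ _ _ emb2_monoid).

Lemma emb2_eq0 x : (emb2 F x == 0) = (x == 0).
Proof. exact: (fmorph_eq0 emb). Qed.

Local Notation map2 := (map_poly (emb2 F)).

Lemma map_emb2B p q : map2 (p - q) = map2 p - map2 q.
Proof. exact: (rmorphB (map_poly emb)). Qed.

Lemma map_emb2D p q : map2 (p + q) = map2 p + map2 q.
Proof. exact: (rmorphD (map_poly emb)). Qed.

Lemma map_emb2M p q : map2 (p * q) = map2 p * map2 q.
Proof. exact: (rmorphM (map_poly emb)). Qed.

Lemma map_emb2_sum n (p : 'I_n -> {poly 'F_2}) : map2 (\sum_i p i) = \sum_i map2 (p i).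
Proof. exact: (rmorph_sum (map_poly emb)). Qed.

Lemma map_emb2Xn n : map2 'X^n = 'X^n.
Proof. exact: (map_polyXn emb). Qed.

Lemma map_emb2C c : map2 c%:P = (emb2 F c)%:P.
Proof. exact: (map_polyC emb). Qed.

(** Placing the parity bit at the field element 0 lets the whole affine group act on the
    positions. *)
Definition beta i : F := if (i < N - 1)%N then alpha ^+ i else 0.

Lemma N_gt1 : (1 < N)%N. Proof. by rewrite -{1}(expn0 2) ltn_exp2l. Qed.

Lemma alpha_neq0 : alpha != 0.
Proof.
apply/eqP => a0; have := prim_expr_order alpha_prim.
have N1 : (N - 1 != 0)%N by rewrite subn_eq0 -ltnNge N_gt1.
by rewrite a0 expr0n (negbTE N1) => /esym/eqP; rewrite oner_eq0.
Qed.

Lemma beta_inj : injective beta.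
Proof.
move=> i j; rewrite /beta; case: ifP => hi; case: ifP => hj.
- move/eqP; rewrite (eq_prim_root_expr alpha_prim) !modn_small // => /eqP.
  exact: val_inj.
- by move/eqP; rewrite expf_eq0 (negbTE alpha_neq0) andbF.
- by move/esym/eqP; rewrite expf_eq0 (negbTE alpha_neq0) andbF.
- by move=> _; apply: val_inj => /=; have := ltn_ord i; have := ltn_ord j; lia.
Qed.

Lemma beta_bij : bijective beta.
Proof. by apply: inj_card_bij; [exact: beta_inj|rewrite card_ord cardF]. Qed.

(** Since [0 ^+ 0 = 1], the syndrome of index 0 is the overall parity, whereas those of positive
    index ignore the parity bit. *)
Definition synd k y : F := \sum_i emb (y i) * beta i ^+ k.

(* The index is shifted: eBCH(v,m) is [Cd v.+1]. *)
Definition Cd k : {set word} := [set y | [forall s : 'I_k, synd s y == 0]].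

Lemma CdP k y : reflect (forall s, (s < k)%N -> synd s y = 0) (y \in Cd k).
Proof.
rewrite inE; apply: (iffP forallP) => [h s sk|h s]; last by rewrite h.
exact/eqP/(h (Ordinal sk)).
Qed.

Lemma syndB k y y' : synd k (y - y') = synd k y - synd k y'.
Proof.
rewrite /synd -sumrB; apply: eq_bigr => i _.
by rewrite !ffunE rmorphB mulrBl.
Qed.

Lemma Cd0 k : 0 \in Cd k.
Proof. by apply/CdP => s _; rewrite -(subrr (0 : word)) syndB subrr. Qed.

Lemma CdB k y y' : y \in Cd k -> y' \in Cd k -> y - y' \in Cd k.
Proof. by move=> /CdP h /CdP h'; apply/CdP => s sk; rewrite syndB h // h' // subrr. Qed.

Lemma CdD k y y' : y \in Cd k -> y' \in Cd k -> y + y' \in Cd k.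
Proof. by move=> h h'; rewrite -[y']opprK CdB // -[- _]sub0r CdB // Cd0. Qed.

(** The syndrome equations extend linearly from monomials to polynomials; the minimum weight and the
    affine invariance both rest on this. *)
Lemma Cd_horner k y (P : {poly F}) : y \in Cd k -> (size P <= k)%N ->
  \sum_i emb (y i) * P.[beta i] = 0.
Proof.
move=> /CdP h sP.
under eq_bigr => i _ do rewrite horner_coef mulr_sumr.
rewrite exchange_big big1 //= => s _.
under eq_bigr => i _ do rewrite mulrCA.
by rewrite -mulr_sumr -/(synd s y) h ?mulr0 // (leq_trans (ltn_ord s)).
Qed.

(** The BCH bound: with at most [k] nonzero bits, a polynomial vanishing on the support except at
    one point would have size at most [k], and [Cd_horner] would isolate that single bit. *)
Lemma Cd_min_weight k y : y \in Cd k -> y != 0 -> (k < #|supp y|)%N.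
Proof.
move=> yC yN0; rewrite ltnNge; apply/negP => hk.
have [i0 i0y] : exists i, i \in supp y.
  apply/set0Pn; apply: contra_neq yN0 => y0; apply/eqP; rewrite -supp_eq0 y0.
  exact: sub0set.
pose P : {poly F} := \prod_(j <- enum (supp y :\ i0)) ('X - (beta j)%:P).
have sP : (size P <= k)%N.
  by rewrite size_prod_XsubC -cardE; move: hk; rewrite (cardsD1 i0) i0y.
have := Cd_horner yC sP; rewrite (bigD1 i0) //= big1 ?addr0.
  move/eqP; rewrite mulf_eq0 emb2_eq0 => /orP[|].
    by move: i0y; rewrite inE => /negbTE ->.
  rewrite -/(root P _) /P -(big_map beta xpredT (fun x => 'X - x%:P)) root_prod_XsubC.
  by rewrite (mem_map beta_inj) mem_enum !inE eqxx.
move=> j ji0; have [yj|yj] := eqVneq (y j) 0; first by rewrite yj mul0r.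
suff /rootP -> : root P (beta j) by rewrite mulr0.
rewrite /P -(big_map beta xpredT (fun x => 'X - x%:P)) root_prod_XsubC.
by rewrite (mem_map beta_inj) mem_enum !inE ji0 yj.
Qed.

Lemma card_Cd0 : #|Cd 0| = (2 ^ N)%N.
Proof.
have -> : Cd 0 = setT by apply/setP => y; rewrite [RHS]inE; apply/CdP.
by rewrite cardsT card_ffun card_Fp // card_ord.
Qed.

Lemma card_CdN : #|Cd N| = 1%N.
Proof.
apply/eqP/cards1P; exists 0; apply/setP => y; rewrite [RHS]inE.
apply/idP/eqP => [yC|->]; last exact: Cd0.
apply/eqP; apply: contraT => /(Cd_min_weight yC).
by have := max_card (supp y); rewrite card_ord leqNgt => /negP.
Qed.

(** Each nonempty fibre of [synd k] on [Cd k] is carried into [Cd k.+1] by subtracting one of its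
    members. *)
Lemma card_CdS k : (#|Cd k| <= #|F| * #|Cd k.+1|)%N.
Proof.
rewrite -sum1_card (partition_big (synd k) xpredT) //= -sum_nat_const.
apply: leq_sum => z _; rewrite sum1_card.
have [y0 /andP[y0C /eqP y0z]|none] := pickP [pred y | (y \in Cd k) && (synd k y == z)]; last first.
  by rewrite eq_card0 // => y; rewrite -[RHS](none y) !inE.
pose t y : word := y - y0.
have tI : injective t by apply: addIr.
rewrite -(card_image tI); apply: subset_leq_card; apply/subsetP => _ /imageP[y + ->].
rewrite unfold_in => /andP[yC /eqP yz]; apply/CdP => s; rewrite ltnS leq_eqVlt.
move=> /orP[/eqP ->|sk]; first by rewrite syndB yz y0z subrr.
by have /CdP -> := CdB yC y0C.
Qed.

(** The syndrome of index [l] of the permuted word pairs [y] with [(a X + b)^l], whose degree is at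
    most [l]. *)
Lemma Cd_affine k y (s : 'I_N -> 'I_N) a b : y \in Cd k -> bijective s ->
  (forall i, beta i = a * beta (s i) + b) -> [ffun i => y (s i)] \in Cd k.
Proof.
move=> yC sb sE; apply/CdP => l lk.
pose P : {poly F} := (a *: 'X + b%:P) ^+ l.
have sP : (size P <= k)%N.
  apply: leq_trans (size_exp_leq _ _) _.
  have : (size (a *: 'X + b%:P)%R <= 2)%N.
    rewrite (leq_trans (size_polyD _ _)) // geq_max (leq_trans (size_scale_leq _ _)) ?size_polyX //.
    by rewrite (leq_trans (size_polyC_leq1 _)).
  case: (size _) => [|[|[]]] //= *; rewrite ?mul0n ?mul1n //; lia.
rewrite -[RHS](Cd_horner yC sP) /synd [RHS](reindex s) /=; last exact: onW_bij.
by apply: eq_bigr => i _; rewrite ffunE sE !hornerE.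
Qed.

Lemma Cd_trans2 k (i j i' j' : 'I_N) : i != j -> i' != j' ->
  exists2 s : {perm 'I_N}, code_aut (Cd k) s & s i = i' /\ s j = j'.
Proof.
move=> ij ij'; have [ib bK Kb] := beta_bij.
have dij : beta i - beta j != 0 by rewrite subr_eq0 (inj_eq beta_inj).
have dij' : beta i' - beta j' != 0 by rewrite subr_eq0 (inj_eq beta_inj).
pose a := (beta i' - beta j') / (beta i - beta j).
have aN0 : a != 0 by rewrite mulf_neq0 ?invr_neq0.
pose b := beta i' - a * beta i.
have sI : injective (fun x => ib (a * beta x + b)).
  move=> x x' /(can_inj Kb) /addIr /(mulfI aN0); exact: beta_inj.
pose s := perm sI.
have sE x : beta (s x) = a * beta x + b by rewrite permE Kb.
exists s.
  move=> c; apply/idP/idP => h.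
    have -> : c = [ffun x => [ffun z => c (s z)] ((s^-1)%g x)].
      by apply/ffunP => x; rewrite !ffunE permKV.
    apply: (Cd_affine (a := a) (b := b)) => //; first exact: injF_bij perm_inj.
    by move=> x; rewrite -sE permKV.
  apply: (Cd_affine (a := a^-1) (b := - (a^-1 * b))) => //; first exact: injF_bij perm_inj.
  by move=> x; rewrite sE mulrDr mulKf // addrK.
split; apply: beta_inj; rewrite sE /b; first by rewrite addrC subrK.
by rewrite addrCA -mulrBr -[beta j - _]opprB mulrN /a divfK // opprB addrCA subrr addr0.
Qed.

(** All powers of [alpha] are roots of [X^(N - 1) - 1], so some polynomial qualifies and one of
    least size exists. *)
Lemma is_BCH_gen_exists v : exists g, is_BCH_gen alpha v g.
Proof.
pose Q n := exists g : {poly 'F_2}, [/\ g != 0, has_BCH_roots alpha v g & size g = n].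
have [n [Qn minn]] : exists n, Q n /\ forall k, Q k -> (n <= k)%N.
  have : exists n, pbool (Q n).
    exists (N - 1).+1; rewrite /pbool; case: ClassicalEpsilon.excluded_middle_informative => // h.
    case: h; exists ('X^(N - 1) - 1); split.
    - by rewrite -size_poly_eq0 size_XnsubC // subn_gt0 N_gt1.
    - move=> i _; rewrite map_emb2B map_emb2Xn -polyC1 map_emb2C.
      rewrite /root !hornerE -exprM mulnC exprM (prim_expr_order alpha_prim) expr1n.
      by rewrite subrr.
    - by rewrite size_XnsubC // subn_gt0 N_gt1.
  have pP k : pbool (Q k) -> Q k.
    by rewrite /pbool; case: ClassicalEpsilon.excluded_middle_informative.
  have Pp k : Q k -> pbool (Q k).
    by rewrite /pbool; case: ClassicalEpsilon.excluded_middle_informative.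
  move=> /ex_minnP[n /pP Qn h]; exists n; split => // k /Pp; exact: h.
have [g [g0 gr gn]] := Qn; exists g; split => //; split => // h h0 hr.
by rewrite gn; apply: minn; exists h.
Qed.

(** The remainder modulo [g] inherits the roots and is smaller than [g], so minimality forces it to
    be 0. *)
Lemma dvdp_BCH_gen v g c : is_BCH_gen alpha v g -> (g %| c) <-> has_BCH_roots alpha v c.
Proof.
move=> [g0 [gr gmin]].
split=> [/dvdpP[q ->] i iv|cr].
  rewrite map_emb2M rootM; apply/orP; right; exact: gr.
rewrite /dvdp; apply/negPn/negP => h; 
suff /(gmin _ h) : has_BCH_roots alpha v (c %% g) by rewrite leqNgt ltn_modp g0.
move=> i iv; have := cr i iv; have := gr i iv; rewrite {1}(divp_eq c g).
by rewrite map_emb2D map_emb2M /root !hornerE => /eqP ->; rewrite mulr0 add0r.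
Qed.

(** The syndrome of index 0 is the parity check; that of index [s > 0] is the value at [alpha ^+ s]
    of the polynomial of the truncated word. *)
Lemma eBCHE v : eBCH alpha m v = Cd v.+1.
Proof.
have lastP : (N.-1 < N)%N by rewrite prednK // expn_gt0.
pose i0 : 'I_N := Ordinal lastP.
apply/setP => y; rewrite inE /BCH inE.
set w := [ffun i => _].
have synd0 : (\sum_(i < N) y i == 0) = (synd 0 y == 0).
  rewrite /synd -(fmorph_eq0 emb) rmorph_sum; congr (_ == 0).
  by apply: eq_bigr => i _; rewrite expr0 mulr1.
have syndS s : (0 < s)%N -> synd s y = (map_poly (emb2 F) (\sum_(i < N - 1) (w i)%:P * 'X^i)).[alpha ^+ s].
  move=> s0; rewrite /synd (big_ord_widen_last _ (i0 := i0)) // {2}/beta /= -subn1 ltnn.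
  rewrite expr0n eqn0Ngt s0 mulr0 addr0 map_emb2_sum horner_sum.
  apply: eq_bigr => i _; rewrite map_emb2M map_emb2C map_emb2Xn !hornerE /= /w ffunE.
  by rewrite /beta /= ltn_ord -!exprM mulnC.
have BCHE : pbool (BCH_word alpha v w) <-> (forall s, (0 < s <= v)%N -> synd s y = 0).
  rewrite /pbool; case: ClassicalEpsilon.excluded_middle_informative => [[g [gg gw]]|h].
    split=> // _ s sv; rewrite syndS; last by case/andP: sv.
    exact/rootP/(iffLR (dvdp_BCH_gen _ gg) gw).
  split=> // hs; case: h; have [g gg] := is_BCH_gen_exists v.
  exists g; split => //; apply/(dvdp_BCH_gen _ gg) => s sv; apply/rootP.
  by rewrite -syndS ?hs //; case/andP: sv.
apply/andP/CdP => [[/BCHE h h0] [_|s]|h].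
- by apply/eqP; rewrite -synd0.
- by rewrite ltnS => sv; apply: h.
split; first by apply/BCHE => s /andP[_ sv]; apply: h.
by rewrite synd0 h.
Qed.
End BCHcode.

(** * Dimension of the codes and choice of the parameters *)

Section Dimension.
Variables (F : finFieldType) (alpha : F) (m : nat).
Hypotheses (m_gt0 : (0 < m)%N) (cardF : #|F| = (2 ^ m)%N)
  (alpha_prim : primitive_root_of_unity (2 ^ m - 1) alpha).
Local Notation N := (2 ^ m)%N.
Local Notation Cd := (Cd alpha cardF).
Local Notation dim C := (logn 2 #|C|).
Local Notation Cd0 := (Cd0 alpha cardF).

Lemma card_Cd k : #|Cd k| = (2 ^ dim (Cd k))%N.
Proof. by apply: card_code_pow2; [exact: Cd0|exact: CdD]. Qed.

Lemma dim_CdS k : (dim (Cd k) <= m + dim (Cd k.+1))%N.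
Proof.
rewrite -(@leq_exp2l 2) // expnD -!card_Cd.
by have := card_CdS alpha cardF k; rewrite {1}cardF.
Qed.

Lemma dim_Cd_ge k : (N <= dim (Cd k) + m * k)%N.
Proof.
elim: k => [|k IH]; first by rewrite muln0 addn0 card_Cd0 pfactorK.
by have := dim_CdS k; rewrite mulnS; lia.
Qed.

(** The least [k] with dimension at most [r N] works, as lowering it by one regains at most [m]
    dimensions. The guard forces [k >= 2], that is [v >= 1]; when it fails, [v = 1] is a dummy
    value. *)
Lemma exists_rate (R : realFieldType) (r : R) : 0 < r -> r < 1 ->
  exists v, (1 <= v <= N - 1)%N /\ (m%:R < (1 - r) * N%:R ->
    (dim (Cd v.+1))%:R <= r * N%:R /\ r * N%:R - m%:R <= (dim (Cd v.+1))%:R).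
Proof.
move=> r0 r1; have N1 := N_gt1 m_gt0.
have N0 : 0 < N%:R :> R by rewrite ltr0n ltnW.
have [big|small] := boolP (m%:R < (1 - r) * N%:R); last first.
  by exists 1%N; split; [rewrite /= subn_gt0|].
have : exists k, (dim (Cd k))%:R <= r * N%:R.
  by exists N; rewrite (card_CdN m_gt0 cardF alpha_prim) logn1 mulr_ge0 ?ler0n // ltW.
case/ex_minnP => k hk kmin.
have kN : (k <= N)%N.
  by apply: kmin; rewrite (card_CdN m_gt0 cardF alpha_prim) logn1 mulr_ge0 ?ler0n // ltW.
have k2 : (1 < k)%N.
  rewrite ltnNge; apply/negP => k1; have := dim_Cd_ge k.
  rewrite -(ler_nat R) natrD => h.
  have : (m * k)%:R <= m%:R :> R by rewrite ler_nat -{2}(muln1 m) leq_mul2l k1 orbT.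
  by move: big h hk; rewrite mulrBl mul1r => *; lra.
case: k => [//|v] in hk kmin kN k2 *; exists v; split; first by apply/andP; split; lia.
move=> _; split => //; have := dim_CdS v; rewrite -(ler_nat R) natrD => h.
have : r * N%:R < (dim (Cd v))%:R by rewrite ltNge; apply/negP => /kmin; rewrite ltnn.
lra.
Qed.

(** As [d.+2 <= 2^(d+1)], the product is at most [2^((2q + 3) d + 3)]. Taking [d] as the quotient of
    [m - 4] by [2q + 3] keeps this below [2^(m-1)], and [d] is still of order [m]. *)
Lemma exists_degree (q : nat) : (1 < q)%N -> (4 <= m)%N ->
  exists2 d, ((2 ^ q) ^ (2 * d) * d.+2 ^ 3 <= N.-1)%N & (m <= d.+2 * (2 * q + 3))%N.
Proof.
move=> q1 m4; set L := (2 * q + 3)%N; have L0 : (0 < L)%N by rewrite addn_gt0 orbT.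
exists ((m - 4) %/ L)%N; set d := (_ %/ _)%N; last first.
  have e := divn_eq (m - 4) L; have l := ltn_pmod (m - 4) L0; rewrite -/d in e.
  have : (4 <= L)%N by rewrite /L; lia.
  rewrite !mulSn; lia.
have dL : (d * L <= m - 4)%N by apply: leq_trunc_div.
apply: (@leq_trans (2 ^ (m - 1))); last first.
  rewrite -(subnK m_gt0) addn1 subn1 /= expnS; have := expn_gt0 2 m.-1; lia.
apply: (@leq_trans (2 ^ (q * (2 * d)) * (2 ^ d.+1) ^ 3)).
  by rewrite -expnM leq_mul2l leq_exp2r // (ltn_expl d.+1) ?orbT.
rewrite -expnM -expnD leq_exp2l //; rewrite /L in dL; nia.
Qed.

(** In [undecodable_bound], [dmin] is [v.+2] and [n = d.+2] is at least [m / (2q + 3)]. The surplus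
    factor [N / dmin] is at most [m / (1 - r)], leaving a failure probability of order [1/m]. *)
Lemma eBCH_undecodable (R : rcfType) (r x dl eta : R) (q v : nat) :
  0 < x -> 0 < dl -> x + 2 * dl < 1 -> 0 < eta -> 0 < r -> r < 1 ->
  (1 < q)%N -> 3 <= (2 ^ q)%:R ^+ 2 * (x * (1 - (x + 2 * dl))) ->
  r <= (1 - eta) * (1 - (x + 2 * dl)) -> (4 <= m)%N ->
  (dim (Cd v.+1))%:R <= r * N%:R ->
  Ex x (fun E => (undecodable (Cd v.+1) E)%:R) * m%:R * ((eta * dl) ^+ 2 * (1 - r))
    <= (2 * q + 3)%:R ^+ 2.
Proof.
move=> x0 dl0 z1 eta0 r0 r1 q1 b2s hr m4 hK.
have [d hd mL] := exists_degree q1 m4.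
have cardI : #|'I_N| = N := card_ord N.
set P := Ex _ _.
have P0 : 0 <= P by apply: Ex_ge0 => [||E]; rewrite ?ler0n //; lra.
have b4 : 4 <= (2 ^ q)%:R :> R by rewrite (ler_nat R 4) (@leq_pexp2l 2 2).
have hN : (2 ^ q)%:R ^+ (2 * d) * d.+2%:R ^+ 3 <= #|'I_N|.-1%:R :> R.
  by rewrite cardI -!natrX -natrM ler_nat.
have := undecodable_bound (Cd0 _) (@CdD _ alpha _ cardF v.+1)
  (Cd_trans2 m_gt0 cardF alpha_prim v.+1) _ x0 dl0 z1 eta0 b4 b2s hN _ hr
  (Cd_min_weight m_gt0 alpha_prim (k := v.+1)).
rewrite cardI => /(_ (N_gt1 m_gt0) hK); rewrite -/P.
have hv : (1 - r) * N%:R <= v.+2%:R * m%:R.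
  have := dim_Cd_ge v.+1; rewrite -(ler_nat R) natrD => h.
  have : (m * v.+1)%:R <= v.+2%:R * m%:R :> R by rewrite -natrM ler_nat mulnC leq_mul2r leqnSn orbT.
  lra.
have N0 : 0 < N%:R :> R by rewrite ltr0n expn_gt0.
have M0 : 0 < m%:R :> R by rewrite ltr0n.
have hm : m%:R <= d.+2%:R * (2 * q + 3)%:R :> R by rewrite -natrM ler_nat.
set L := (2 * q + 3)%:R in hm *; set n := d.+2%:R in hm *; set w := v.+2%:R in hv *.
have L0 : 0 <= L by rewrite ler0n.
have n0 : 0 <= n by rewrite ler0n.
set e := eta * dl; have e0 : 0 < e by rewrite mulr_gt0.
rewrite -mulrA -/e => hu.
rewrite -(ler_pM2r N0) -(ler_pM2r M0).
apply: le_trans (_ : (n * L) ^+ 2 * (e ^+ 2 * P * (w * m%:R)) <= _); last first.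
  have -> : (n * L) ^+ 2 * (e ^+ 2 * P * (w * m%:R)) =
    L ^+ 2 * ((n * e) ^+ 2 * (w * P)) * m%:R by ring.
  by rewrite ler_pM2r // ler_wpM2l ?sqr_ge0.
have -> : P * m%:R * (e ^+ 2 * (1 - r)) * N%:R * m%:R =
  m%:R ^+ 2 * (e ^+ 2 * P * ((1 - r) * N%:R)) by ring.
apply: ler_pM; rewrite ?sqr_ge0 //.
- apply: mulr_ge0; first by rewrite mulr_ge0 ?sqr_ge0.
  by rewrite mulr_ge0 ?ler0n // subr_ge0 ltW.
- by rewrite ler_pXn2r // nnegrE ?mulr_ge0 // ltW.
- by rewrite ler_wpM2l // mulr_ge0 ?sqr_ge0.
Qed.
End Dimension.

(** * Asymptotics *)

(** Subtracting [x] turns a competing codeword into a nonzero codeword supported by the erasures, so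
    ambiguity does not depend on [x]. *)
Lemma ambiguousE n (C : {set {ffun 'I_n -> 'F_2}}) x (E : {set 'I_n}) :
  (forall c c', c \in C -> c' \in C -> c + c' \in C) ->
  (forall c c', c \in C -> c' \in C -> c - c' \in C) ->
  x \in C -> ambiguous C x E = undecodable C E.
Proof.
move=> CD CB xC; apply/exists_inP/exists_inP => -[c cC /andP[cN0 h]].
  exists (c - x); first exact: CB.
  rewrite subr_eq0 cN0; apply/subsetP => i; rewrite inE !ffunE subr_eq0.
  by apply: contraR => iE; apply: (implyP (forallP h i)).
exists (x + c); first exact: CD.
rewrite -subr_eq0 addrAC subrr add0r cN0; apply/forallP => i; apply/implyP => iE.
rewrite ffunE -subr_eq0 addrAC subrr add0r; apply: contraR iE => ci.
by apply: (subsetP h); rewrite inE.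
Qed.

Lemma PBE n (C : {set {ffun 'I_n -> 'F_2}}) (p : R) : 0 \in C ->
  (forall c c', c \in C -> c' \in C -> c + c' \in C) ->
  (forall c c', c \in C -> c' \in C -> c - c' \in C) ->
  PB C p = Ex p (fun E => (undecodable C E)%:R).
Proof.
move=> C0 CD CB.
have cN0 : #|C|%:R != 0 :> R by rewrite pnatr_eq0 -lt0n; apply/card_gt0P; exists 0.
transitivity (\sum_(x in C) \sum_(E : {set 'I_n})
   #|C|%:R^-1 * (bmeas p E * (undecodable C E)%:R) : R).
  apply: eq_bigr => x xC; apply: eq_bigr => E _.
  rewrite (ambiguousE E CD CB xC) !RmultE !RpowE RinvE INRE RminusE bmeasE card_ord -!mulrA.
  by congr (_ * (_ * (_ * _))); case: (undecodable C E).
by rewrite sumr_const -mulr_sumr -/(Ex p _) -[LHS]mulr_natl mulrA divff ?mul1r.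
Qed.

Lemma rateE n (C : {set {ffun 'I_n -> 'F_2}}) k : #|C| = (2 ^ k)%N -> rate C = k%:R / n%:R.
Proof.
move=> cC; rewrite /rate cC [LHS]RdivE [INR n]INRE; congr (_ / _).
have -> : INR (2 ^ k) = pow 2 k by rewrite INRE RpowE natrX.
rewrite ln_pow; last by apply: Rlt_0_2.
rewrite INRE /Rdiv Rmult_assoc Rinv_r ?Rmult_1_r //.
by apply/eqP; rewrite gt_eqF //; apply/RltP; have := ln_lt_2; Lra.lra.
Qed.

Lemma Un_cv_bound (u : nat -> R) (l K : R) (M : nat) :
  (forall m, (M <= m)%N -> `|u m - l| * m%:R <= K) -> Un_cv u l.
Proof.
move=> h eps eps_gt0; have /RltP eps0 := eps_gt0.
have [n hn] := INR_archimed eps K eps_gt0.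
exists (maxn M n.+1) => m /ssrnat.leP; rewrite geq_max => /andP[Mm nm].
rewrite RdistE; apply/RltP.
have m0 : 0 < m%:R :> R by rewrite ltr0n (leq_trans _ nm).
rewrite -(ltr_pM2r m0); apply: le_lt_trans (h m Mm) _.
move/RltP: hn; rewrite INRE RmultE => /lt_le_trans; apply.
by rewrite mulrC ler_pM2l // ler_nat ltnW.
Qed.

(** The factor 2 accommodates [m = 3]. *)
Lemma sqr_le_exp2 m : (m * m <= 2 * 2 ^ m)%N.
Proof.
elim: m => [|[|[|[|m]]] IH] //; rewrite expnS; move: IH.
by move: (2 ^ _)%N => X; nia.
Qed.

Lemma lt_mul_exp2 (e : R) m : 0 < e -> 2 < e * m%:R -> m%:R < e * (2 ^ m)%:R.
Proof.
move=> e0 em.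
have m0 : 0 < m%:R :> R.
  by rewrite ltNge; apply/negP => m0; have := mulr_ge0_le0 (ltW e0) m0; lra.
have h2 : m%:R * m%:R <= 2 * (2 ^ m)%:R :> R by rewrite -!natrM ler_nat sqr_le_exp2.
have h1 : e * (m%:R * m%:R) <= e * (2 * (2 ^ m)%:R) by rewrite ler_pM2l.
have : 2 * m%:R < e * m%:R * m%:R by rewrite ltr_pM2r.
lra.
Qed.

Lemma exists_nat_gt (x : R) : exists n : nat, x < n%:R.
Proof.
have [n hn] := INR_archimed 1 x Rlt_0_1; exists n.
by move/RltP: hn; rewrite INRE RmultE mulr1.
Qed.

Lemma gap_constants (p r : R) : 0 < p -> 0 < r -> p < 1 - r ->
  exists dl eta : R, [/\ 0 < dl, 0 < eta, p + 2 * dl < 1 &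
    r <= (1 - eta) * (1 - (p + 2 * dl))].
Proof.
(* [z] is the midpoint of [p] and [1 - r]; [eta] is chosen to turn the last inequality into an
   equality. *)
move=> p0 r0 pr; pose z := (p + 1 - r) / 2.
have z1 : 0 < 1 - z by rewrite /z; lra.
exists ((1 - r - p) / 4), (1 - r / (1 - z)); split.
- by lra.
- by rewrite subr_gt0 ltr_pdivrMr // mul1r /z; lra.
- by lra.
- have -> : p + 2 * ((1 - r - p) / 4) = z by rewrite /z; field.
  by rewrite opprB addrC subrK divfK // gt_eqF.
Qed.

Lemma exists_exponent (s0 : R) : 0 < s0 -> exists2 q : nat, (1 < q)%N & 3 <= (2 ^ q)%:R ^+ 2 * s0.
Proof.
move=> s0_gt0; have [n hn] := exists_nat_gt (3 / s0); exists n.+2 => //.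
have h : n%:R <= (2 ^ n.+2)%:R :> R by rewrite ler_nat (leq_trans _ (ltnW (ltn_expl n.+2 _))) // ltnW.
have h1 : 1 <= (2 ^ n.+2)%:R :> R by rewrite ler1n expn_gt0.
rewrite -ler_pdivrMr //; apply: le_trans (ltW hn) _; apply: (le_trans h).
by rewrite expr2 ler_peMl // (le_trans ler01).
Qed.

Local Open Scope R_scope.

Theorem theorem9
  (F : nat -> finFieldType) (alpha : forall m : nat, F m)
  (hF : forall m : nat, (0 < m)%N -> #|F m| = (2 ^ m)%N)
  (halpha : forall m : nat, (0 < m)%N -> primitive_root_of_unity (2 ^ m - 1) (alpha m))
  (r : R) (hr : 0 < r < 1) :
  exists v : nat -> nat,
    (forall m : nat, (0 < m)%N -> (1 <= v m <= 2 ^ m - 1)%N) /\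
    Un_cv (fun m => rate (eBCH (alpha m) m (v m))) r /\
    (forall p : R, 0 <= p < 1 - r ->
       Un_cv (fun m => PB (eBCH (alpha m) m (v m)) p) 0).
Proof.
case: hr => /RltP r0 /RltP r1.
have r1' : (0 < 1 - r)%R by rewrite subr_gt0.
(* [Cd] depends on the proof of [0 < m] through [hF]; quantifying over it inside makes [Q 0] vacuous
   and lets choice range over all [m]. *)
pose Q m v := forall m0 : (0 < m)%N, (1 <= v <= 2 ^ m - 1)%N /\
   ((m%:R < (1 - r) * (2 ^ m)%:R)%R ->
    ((logn 2 #|Cd (alpha m) (hF m m0) v.+1|)%:R <= r * (2 ^ m)%:R)%R /\
    (r * (2 ^ m)%:R - m%:R <= (logn 2 #|Cd (alpha m) (hF m m0) v.+1|)%:R)%R).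
have hv m : exists v, Q m v.
  have [m0|m0] : (0 < m)%N \/ ~ (0 < m)%N by case: (0 < m)%N; [left|right].
    2: by exists 0%N => m0'; case: (m0 m0').
  have [v hv] := exists_rate m0 (hF m m0) (halpha m m0) r0 r1.
  by exists v => m0'; rewrite (bool_irrelevance m0' m0).
have {hv} [v hv] : {v : nat -> nat & forall m, Q m (v m)}.
  have w m := ClassicalEpsilon.constructive_indefinite_description _ (hv m).
  by exists (fun m => sval (w m)) => m; apply: svalP.
exists v; split; first by move=> m m0; have [] := hv m m0.
have [M0 hM0] := exists_nat_gt (2 / (1 - r))%R.
(* From [M] on, [exists_degree] applies and the guard in [Q] holds. *)
pose M := maxn 4 M0.
have big m : (M <= m)%N -> (m%:R < (1 - r) * (2 ^ m)%:R)%R.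
  rewrite geq_max => /andP[_ Mm]; apply: lt_mul_exp2 => //.
  rewrite mulrC -ltr_pdivrMr //; apply: (lt_le_trans hM0).
  by rewrite ler_nat.
have pos m : (M <= m)%N -> (0 < m)%N by rewrite geq_max => /andP[m4 _]; apply: leq_trans m4.
split.
  (* The rate misses [r] by at most [m / N], and [m * m <= 2 * N]. *)
  apply: (@Un_cv_bound _ _ 2%R M) => m Mm; have m0 := pos m Mm.
  have [_ /(_ (big m Mm))[h1 h2]] := hv m m0.
  rewrite (eBCHE m0 (hF m m0) (halpha m m0)) (rateE (card_Cd _ _ _)).
  set k := (_%:R)%R in h1 h2 *.
  have N0 : (0 < (2 ^ m)%:R :> R)%R by rewrite ltr0n expn_gt0.
  rewrite -(ler_pM2r N0) mulrAC -{2}(gtr0_norm N0) -normrM mulrBl divfK ?gt_eqF //.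
  apply: le_trans (_ : m%:R * m%:R <= _)%R; last by rewrite -!natrM ler_nat sqr_le_exp2.
  by rewrite ler_wpM2r ?ler0n // ler_norml; apply/andP; split; lra.
move=> p [/RleP p0 /RltP p1].
(* The Fourier analysis requires [p > 0]; at [p = 0] nothing is erased and decoding never fails. *)
move: p0; rewrite le_eqVlt => /orP[/eqP p0|p0].
  apply: (@Un_cv_bound _ _ 0%R M) => m Mm; have m0 := pos m Mm.
  rewrite (eBCHE m0 (hF m m0) (halpha m m0)) (PBE _ (Cd0 _ _ _)).
  - by rewrite -p0 Ex_at0 undecodable_set0 subr0 normr0 mul0r.
  - by move=> *; apply: CdD.
  - by move=> *; apply: CdB.
have [dl [eta [dl0 eta0 z1 hr]]] := gap_constants p0 r0 p1.
have s0 : (0 < p * (1 - (p + 2 * dl)))%R by rewrite mulr_gt0 // subr_gt0.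
have [q q1 hq] := exists_exponent s0.
have e0 : (0 < (eta * dl) ^+ 2 * (1 - r))%R by rewrite mulr_gt0 // exprn_gt0 // mulr_gt0.
apply: (@Un_cv_bound _ _ ((2 * q + 3)%:R ^+ 2 / ((eta * dl) ^+ 2 * (1 - r)))%R M) => m Mm.
have m0 := pos m Mm; have m4 : (4 <= m)%N by move: Mm; rewrite geq_max => /andP[].
have [_ /(_ (big m Mm))[h1 h2]] := hv m m0.
rewrite (eBCHE m0 (hF m m0) (halpha m m0)) PBE; last first.
- by move=> *; apply: CdB.
- by move=> *; apply: CdD.
- exact: Cd0.
rewrite ler_pdivlMr // subr0 ger0_norm; last first.
  by apply: Ex_ge0 => [||E]; rewrite ?ler0n // ltW //; lra.
exact: (eBCH_undecodable m0 (halpha m m0) p0 dl0 z1 eta0 r0 r1 q1 hq hr m4 h1).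
Qed.
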